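(* Let $A,B\in\mathbb{C}^{N\times N}$ be commuting matrices such that $A+I+sI$ and $\frac12A+B+I+sI$ are invertible for every integer $s\ge0$. Then for every integer $n\ge3$ and $z\in\mathbb{C}\setminus(-\infty,0]$, $$\begin{aligned}n(A+nI)\mathbf{J}_n^{A,B}(z)={}&\left[\left(B+nI+\tfrac12A\right)(A+nI)+(n-1)\left(B+\tfrac32A+2nI-I\right)-z^2I\right]\mathbf{J}_{n-1}^{A,B}(z)\\&-\left(B+\tfrac12A+nI-I\right)\left(B+\tfrac32A+3nI-3I\right)\mathbf{J}_{n-2}^{A,B}(z)\\&+\left(B+\tfrac12A+nI-I\right)\left(B+\tfrac12A+nI-2I\right)\mathbf{J}_{n-3}^{A,B}(z).\end{aligned}$$
   Context: $I$ is the $N\times N$ identity matrix; for $M\in\mathbb{C}^{N\times N}$, $(M)_0=I$ and $(M)_k=M(M+I)\cdots(M+(k-1)I)$ for $k\ge1$. $\Gamma(M)$ and $\Gamma^{-1}(M)$ (the reciprocal gamma function, entire) are defined by the holomorphic functional calculus, and $z^M=\exp(M\log z)$ with the principal logarithm. For $n\ge0$ the Bateman matrix polynomials are $$\mathbf{J}_n^{A,B}(z)=\frac{\Gamma(\frac12A+B+nI+I)}{n!}\Gamma^{-1}(A+I)\Gamma^{-1}\left(\tfrac12A+B+I\right)z^A\,{}_1F_2\left(-nI;A+I,B+\tfrac12A+I;z^2\right),$$ where ${}_1F_2(P;Q,R;w)=\sum_{k\ge0}\frac{w^k}{k!}(P)_k[(Q)_k]^{-1}[(R)_k]^{-1}$.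 *)

(* Defs.v *)
From mathcomp Require Import all_boot all_order all_algebra.
From mathcomp Require Import complex.
From mathcomp Require Import all_classical all_reals all_analysis.
Set Implicit Arguments.
Unset Strict Implicit.
Unset Printing Implicit Defensive.
Import Order.TTheory GRing.Theory Num.Theory numFieldNormedType.Exports.
Local Open Scope classical_set_scope.
Local Open Scope complex_scope.
Local Open Scope ring_scope.

(* N x N matrices have type 'M_N.+1, so that they form a unitary ring with    *)
(* units: products, integer constants n%:R = n I, and inverses are those of   *)
(* this ring.  Its ring inverse is the identity on non-invertible matrices.   *)

(* Gamma and its reciprocal, as functions of a complex variable. *)
Section ScalarFunctions.
Variable R : realType.
Implicit Types z : R[i].

Definition Cexp z : R[i] :=
  (expR (complex.Re z))%:C * (cos (complex.Im z) +i* sin (complex.Im z)).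

(* The argument in ]-pi, pi], for z != 0. *)
Definition Carg z : R :=
  let t := acos (complex.Re z / complex.Re `|z|) in
  if 0 <= complex.Im z then t else - t.

Definition Clog z : R[i] := ln (complex.Re `|z|) +i* Carg z.

(* Euler's limit  n! n^z / (z (z+1) ... (z+n)),  where n^z = exp (z log n).   *)
(* At the poles 0, -1, -2, ... the terms are eventually x / 0 = 0, so that    *)
(* Cgamma z = 0 there.                                                        *)
Definition Cgamma z : R[i] :=
  limn (fun n => n`!%:R * Cexp (z * (ln n%:R)%:C)
                  / \prod_(0 <= k < n.+1) (z + k%:R) : R[i]^o).

(* By the above it takes the value 0 at the poles of Cgamma, hence it is the  *)
(* entire function 1 / Gamma.                                                 *)
Definition Crgamma z : R[i] := (Cgamma z)^-1.

End ScalarFunctions.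

Section MatrixFunctions.
Variables (K : numClosedFieldType) (N : nat).
Implicit Types (M P Q : 'M[K]_N.+1) (f : K -> K).

(* Holomorphic functional calculus in finite dimension (Dunford-Schwartz,     *)
(* VII.1): f(M) := p(M) for any polynomial p such that p^(j)(a) = f^(j)(a)    *)
(* for every eigenvalue a of M and every j < nu(a), where the index nu(a) of  *)
(* a is its multiplicity in the minimal polynomial of M (and 0 when a is not  *)
(* an eigenvalue).  Any two such p differ by a multiple of the minimal        *)
(* polynomial, so p(M) does not depend on the choice made by xget.            *)
Definition jet_interp f M (p : {poly K}) : Prop :=
  forall (a : K) (j : nat), (j < mup a (mxminpoly M))%N ->
    (derivn j p).[a] = derive1n j f a.

Definition mxfun f M : 'M[K]_N.+1 := horner_mx M (xget 0 (jet_interp f M)).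

Definition mxexp M : 'M[K]_N.+1 :=
  limn (series (fun k => k`!%:R^-1 *: M ^+ k)).

Definition mxpoch M (k : nat) : 'M[K]_N.+1 := \prod_(0 <= i < k) (M + i%:R).

Definition mxhyp12 P Q (T : 'M[K]_N.+1) (w : K) : 'M[K]_N.+1 :=
  limn (series (fun k =>
    (w ^+ k / k`!%:R) *: (mxpoch P k * (mxpoch Q k)^-1 * (mxpoch T k)^-1))).

End MatrixFunctions.

Section Bateman.
Variables (R : realType) (N : nat).
Implicit Types (A B : 'M[R[i]]_N.+1) (z : R[i]).

Definition mxcpow z A : 'M[R[i]]_N.+1 := mxexp (Clog z *: A).

Definition bateman (n : nat) A B z : 'M[R[i]]_N.+1 :=
  n`!%:R^-1 *:
    (mxfun (@Cgamma R) (2^-1 *: A + B + n%:R + 1) *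
     mxfun (@Crgamma R) (A + 1) *
     mxfun (@Crgamma R) (2^-1 *: A + B + 1) *
     mxcpow z A *
     mxhyp12 (- n%:R) (A + 1) (B + 2^-1 *: A + 1) (z ^+ 2)).

End Bateman.

(* Main.v *)
Require Import Defs.
From mathcomp Require Import all_boot all_order all_algebra.
From mathcomp Require Import complex.
From mathcomp Require Import all_classical.
From mathcomp Require Import all_reals all_analysis.
From mathcomp Require Import ring lra.
Set Implicit Arguments.
Unset Strict Implicit.
Unset Printing Implicit Defensive.
Import Order.TTheory GRing.Theory Num.Theory numFieldNormedType.Exports.
Import Normc.
Local Open Scope classical_set_scope.
Local Open Scope complex_scope.
Local Open Scope ring_scope.

(** Put C := A/2 + B + I and w := z^2.  Since (-n)_k / k! = (-1)^k binomial(n, k),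
    the hypergeometric series stops at k = n and
      J_n = 1/n! Gamma(C + n) Gamma^-1(A + I) Gamma^-1(C) z^A
            sum_(k <= n) (-w)^k binomial(n, k) [(A + I)_k]^-1 [(C)_k]^-1.
    If Gamma(C + n) = (C)_n Gamma(C), then J_n = W U_n, where W is a factor that
    does not depend on n and commutes with A and C, and
      U_n = 1/n! (C)_n sum_(k <= n) (-w)^k binomial(n, k) D_k,
      D_k = [(A + I)_k]^-1 [(C)_k]^-1.
    It remains to prove the recurrence for U_n.  The factor (C)_(n-1) D_k can be
    pulled out of the terms in w^k: the coefficients of U_(n-2) and U_(n-3) complete
    (C)_(n-2) and (C)_(n-3), while D_(k-1) = (A + k)(C + k - 1) D_k takes care of
    the term in z^2 [bateman_poly_expand, bateman_poly_shift].  What is left is an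
    identity between linear combinations of AC, A, C and I with binomial
    coefficients, which follows from Pascal's rule and absorption
    [bateman_scalar_identity].

    The other half is the functional equation of the matrix Gamma function,
    Gamma(M + I) = M Gamma(M), for M without eigenvalue in {0, -1, -2, ...}.  In the
    functional calculus f(M) is p(M) for a polynomial p that has the same jets as f
    on the spectrum of M; such a p exists by Hermite interpolation
    [hermite_interpolation].  If p and q interpolate Gamma on the spectra of M and
    M + I, then q(X + 1) and X p(X) have the same jets on the spectrum of M, hence
    agree modulo the minimal polynomial [mxfun_functional_equation].  The comparison
    of jets applies the Leibniz rule to z Gamma(z), so it needs that Gamma, defined
    by Euler's limit, is infinitely differentiable off its poles.

    Smoothness comes from bounds on Euler's sequence.  On Re z > 1 the terms
    Gamma_n of the sequence satisfy Gamma_n' = psi_n Gamma_n, where psi_n is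
    ln n - sum_(k <= n) 1/(z + k), and the derivatives of psi_n are sums of powers
    of 1/(z + k) with exponents at least 2.  So the derivatives of every order are
    bounded on half-discs uniformly in n [tame_gamma_seq].  A uniform bound on second
    derivatives gives a uniform second order Taylor estimate, which lets
    derivatives pass to a pointwise limit [tame_limit_derivative]; iterating this
    gives smoothness of the limit.  Pointwise convergence holds because
    Gamma_(n+1) / Gamma_n = 1 + O(1/n^2) [gamma_seq_ratio].  Finally
    Gamma(z) = Gamma(z + 1) / z carries all this from the half-plane to every
    point that is not a pole [gamma_regular]. *)

(** * Complex modulus, limits and derivatives *)

Lemma is_derive1P (K : numFieldType) (f : K -> K) (z l : K) :
  is_derive z 1 f l <->
  forall e : K, 0 < e -> \forall h \near (0 : K),
    `|f (z + h) - f z - l * h| <= e * `|h|.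
Proof.
pose q := fun h : K => h^-1 *: ((f \o shift z) (h *: 1) - f z).
have qE h : h != 0 -> `|q h - l| * `|h| = `|f (z + h) - f z - l * h|.
  move=> h0; rewrite -normrM mulrBl; congr (`|_ - _|); rewrite /q.
  have -> : (f \o shift z) (h *: 1) = f (z + h) by rewrite /= [h%:A]mulr1 addrC.
  by rewrite [h^-1 *: _]mulrC mulfVK.
split=> [[df dl] e e0|H].
  have ql : q @ (0 : K)^' --> l by rewrite -dl; exact: df.
  have /cvgrPdist_le /(_ e e0) := ql; rewrite /dnbhs /within /= => Q.
  near=> h; have [->|h0] := eqVneq h 0.
    by rewrite addr0 subrr mulr0 subr0 !normr0 mulr0.
  rewrite -qE// ler_wpM2r// distrC.
  by move: h0; near: h; exact: Q.
have ql : q @ (0 : K)^' --> l.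
  apply/cvgrPdist_le => e e0.
  have Hd : \forall h \near (0 : K)^', `|f (z + h) - f z - l * h| <= e * `|h|.
    exact: cvg_within (H e e0).
  near=> h; have h0 : h != 0 by near: h; exact: nbhs_dnbhs_neq.
  rewrite distrC -(ler_pM2r (x := `|h|)) ?normr_gt0// qE//.
  by near: h.
apply: DeriveDef; first by apply/cvg_ex; exists l.
exact: cvg_lim ql.
Unshelve. all: by end_near. Qed.

Section ComplexAbs.
Variable R : realType.
Implicit Types (z w h : R[i]).

Lemma normr_normc z : `|z| = (normc z)%:C :> R[i]. Proof. by []. Qed.

Lemma normc_ge0 z : 0 <= normc z.
Proof. by case: z => a b; exact: sqrtr_ge0. Qed.

Lemma normc_gt0 z : (0 < normc z) = (z != 0).
Proof. by rewrite -ltcR -normr_normc normr_gt0. Qed.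

Lemma normc_real (x : R) : normc x%:C = `|x|.
Proof. by rewrite /normc /= expr0n addr0 sqrtr_sqr. Qed.

Lemma normc_nat n : normc (n%:R : R[i]) = n%:R.
Proof. by rewrite -(rmorph_nat (real_complex R)) normc_real ger0_norm. Qed.

Lemma normcB z w : normc (z - w) <= normc z + normc w.
Proof. by rewrite -(normcN w); exact: le_normcD. Qed.

Lemma normc_distC z w : normc (z - w) = normc (w - z).
Proof. by rewrite -normcN opprB. Qed.

Lemma normc_ge_abs z : `|complex.Re z| <= normc z /\ `|complex.Im z| <= normc z.
Proof.
case: z => a b /=; rewrite -!sqrtr_sqr.
by split; rewrite ler_wsqrtr// ?lerDl ?lerDr sqr_ge0.
Qed.

Lemma normc_le_ReIm z : normc z <= `|complex.Re z| + `|complex.Im z|.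
Proof.
have -> : z = (complex.Re z)%:C + 'i%C * (complex.Im z)%:C := complexE z.
apply: le_trans (le_normcD _ _) _; rewrite normcM !normc_real.
by simpc; rewrite /normc /= expr0n expr1n add0r sqrtr1 mul1r.
Qed.

Lemma ReD z w : complex.Re (z + w) = complex.Re z + complex.Re w.
Proof. by case: z w => [a b] [c d]. Qed.

Lemma ReB z w : complex.Re (z - w) = complex.Re z - complex.Re w.
Proof. by case: z w => [a b] [c d]. Qed.

Lemma ImB z w : complex.Im (z - w) = complex.Im z - complex.Im w.
Proof. by case: z w => [a b] [c d]. Qed.

Lemma near0_normcP (P : R[i] -> Prop) :
  (\forall h \near (0 : (R[i] : numFieldType)), P h) <->
  exists2 d : R, 0 < d & forall h, normc h < d -> P h.
Proof.
split=> [/nbhs_norm0P[/= d d0 dP]|[d d0 dP]].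
  have dE : d = (complex.Re d)%:C by rewrite RRe_real// gtr0_real.
  exists (complex.Re d); first by rewrite -ltcR -dE.
  by move=> h hd; apply: dP => /=; rewrite normr_normc dE ltcR.
apply/nbhs_norm0P; exists d%:C => /=; first by rewrite ltcR.
by move=> h /=; rewrite normr_normc ltcR; exact: dP.
Qed.

(** Complex differentiability with real radii and a real-valued modulus, the form in
    which all estimates below are made. *)
Definition cderiv (f : R[i] -> R[i]) z l :=
  forall e : R, 0 < e -> exists2 d : R, 0 < d & forall h, normc h < d ->
    normc (f (z + h) - f z - l * h) <= e * normc h.

Lemma cderivP (f : R[i] -> R[i]) z l :
  cderiv f z l <->
  @is_derive (R[i] : numFieldType) (R[i] : numFieldType) (R[i] : numFieldType)
    z 1 f l.
Proof.
rewrite is_derive1P; split=> H e e0; last first.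
  have /H/near0_normcP[d d0 dP] : 0 < e%:C :> R[i] by rewrite ltcR.
  by exists d => // h /dP; rewrite !normr_normc -rmorphM lecR.
have eE : e = (complex.Re e)%:C by rewrite RRe_real// gtr0_real.
have /H[d d0 dP] : 0 < complex.Re e by rewrite -ltcR -eE.
apply/near0_normcP; exists d => // h /dP.
by rewrite eE !normr_normc -rmorphM lecR.
Qed.

Lemma cvg_normcP (u : nat -> R[i]) (l : R[i]) :
  (u @ \oo --> (l : R[i]^o)) <->
  forall e : R, 0 < e -> \forall n \near \oo, normc (u n - l) <= e.
Proof.
rewrite (@cvgrPdist_le _ (R[i]^o)); split=> H e e0.
  have /H : 0 < e%:C :> R[i] by rewrite ltcR.
  by apply: filterS => n /=; rewrite normr_normc lecR normc_distC.
have eE : e = (complex.Re e)%:C by rewrite RRe_real// gtr0_real.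
have /H : 0 < complex.Re e by rewrite -ltcR -eE.
by apply: filterS => n /=; rewrite eE normr_normc lecR normc_distC.
Qed.

(** Completeness is inherited from the real and imaginary parts. *)
Lemma normc_cauchy_cvg (u : nat -> R[i]) :
  (forall e : R, 0 < e -> exists N, forall m n, (N <= m)%N -> (N <= n)%N ->
    normc (u m - u n) <= e) ->
  exists l : R[i], u @ \oo --> (l : R[i]^o).
Proof.
move=> H.
have cc (g : R[i] -> R) : (forall z w, `|g z - g w| <= normc (z - w)) ->
    cvgn (g \o u).
  move=> gle; apply: cauchy_cvg; apply/cauchy_ballP => e e0.
  have /H[N NP] : 0 < e / 2 by rewrite divr_gt0.
  rewrite near_simpl /=; exists ([set n | (N <= n)%N], [set n | (N <= n)%N]).
    by split; exists N.
  move=> [m n] /= [Nm Nn]; rewrite /ball /=; apply: le_lt_trans (gle _ _) _.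
  by apply: le_lt_trans (NP _ _ Nm Nn) _; rewrite ltr_pdivrMr// ltr_pMr// ltr1n.
have /cc/cvg_ex[/= a ua] z w : `|complex.Re z - complex.Re w| <= normc (z - w).
  by rewrite -ReB; have [] := normc_ge_abs (z - w).
have /cc/cvg_ex[/= b ub] z w : `|complex.Im z - complex.Im w| <= normc (z - w).
  by rewrite -ImB; have [] := normc_ge_abs (z - w).
exists (a +i* b); apply/cvg_normcP => e e0.
have e2 : 0 < e / 2 by rewrite divr_gt0.
have /cvgrPdist_le/(_ _ e2) := ua; have /cvgrPdist_le/(_ _ e2) := ub.
apply: filterS2 => n /= Ib Ra; apply: le_trans (normc_le_ReIm _) _.
rewrite ReB ImB /= (splitr e); apply: lerD; rewrite distrC //.
Qed.

End ComplexAbs.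

(** * Mean value and Taylor inequalities *)

Section ComplexCalculus.
Variable R : realType.
Implicit Types (z w h a b c l : R[i]) (t s : R) (f g df ddf : R[i] -> R[i]).

Lemma cderivD f g z l m : cderiv f z l -> cderiv g z m ->
  cderiv (fun w => f w + g w) z (l + m).
Proof. by move=> /cderivP fl /cderivP gm; apply/cderivP; exact: is_deriveD. Qed.

Lemma cderivM f g z l m : cderiv f z l -> cderiv g z m ->
  cderiv (fun w => f w * g w) z (l * g z + f z * m).
Proof.
move=> /cderivP fl /cderivP gm; apply/cderivP.
rewrite addrC (mulrC l); exact: is_deriveM.
Qed.

Lemma cderiv_cst l z : cderiv (fun=> l) z 0.
Proof. by apply/cderivP; exact: is_derive_cst. Qed.

Lemma cderiv_id z : cderiv id z 1.
Proof. by apply/cderivP; exact: is_derive_id. Qed.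

Lemma cderiv_eq f z l m : cderiv f z l -> l = m -> cderiv f z m.
Proof. by move=> ? <-. Qed.

Lemma cderivZ c f z l : cderiv f z l -> cderiv (fun w => c * f w) z (c * l).
Proof.
by move=> fl; apply: cderiv_eq (cderivM (cderiv_cst c z) fl) _; rewrite mul0r add0r.
Qed.

Lemma cderivB f g z l m : cderiv f z l -> cderiv g z m ->
  cderiv (fun w => f w - g w) z (l - m).
Proof. by move=> /cderivP fl /cderivP gm; apply/cderivP; exact: is_deriveB. Qed.

Lemma cderiv_sum (F G : nat -> R[i] -> R[i]) z n :
  (forall k, cderiv (F k) z (G k z)) ->
  cderiv (fun w => \sum_(k < n) F k w) z (\sum_(k < n) G k z).
Proof.
move=> FG; elim: n => [|n IH].
  rewrite big_ord0; suff -> : (fun w => \sum_(k < 0) F k w) = fun=> 0.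
    exact: cderiv_cst.
  by apply/funext => w; rewrite big_ord0.
rewrite big_ord_recr /=.
have -> : (fun w => \sum_(k < n.+1) F k w) =
          (fun w => \sum_(k < n) F k w + F n w).
  by apply/funext => w; rewrite big_ord_recr.
exact: cderivD.
Qed.

Lemma cderivV c z : z + c != 0 ->
  cderiv (fun w => (w + c)^-1) z (- (z + c) ^- 2).
Proof.
move=> zc0 e e0; set m := normc (z + c); have m0 : 0 < m by rewrite normc_gt0.
have k0 : 0 < e * m ^+ 3 / 2 by rewrite divr_gt0// mulr_gt0// exprn_gt0.
exists (Num.min (m / 2) (e * m ^+ 3 / 2)) => [|h].
  by rewrite lt_min k0 divr_gt0.
rewrite lt_min => /andP[hm hk].
have hn0 := normc_ge0 h.
have mh : m / 2 <= normc (z + h + c).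
  have : m <= normc (z + h + c) + normc h.
    rewrite /m; have -> : z + c = (z + h + c) - h by ring.
    exact: normcB.
  by lra.
have nz : z + h + c != 0 by rewrite -normc_gt0; lra.
have -> : (z + h + c)^-1 - (z + c)^-1 - - (z + c) ^- 2 * h
        = h * h / ((z + c) ^+ 2 * (z + h + c)).
  by field; rewrite nz zc0.
rewrite normcM normcV normcM normcM expr2 normcM -/m.
rewrite ler_pdivrMr; last by rewrite !mulr_gt0// (lt_le_trans _ mh)// divr_gt0.
rewrite -(mulrA e) mulrCA ler_wpM2l//; apply: le_trans (ltW hk) _.
rewrite -(mulrA e) ler_wpM2l ?(ltW e0)// exprSr expr2 -(mulrA (m * m)) ler_wpM2l//.
by rewrite mulr_ge0// ltW.
Qed.

(** Used for r the real and the imaginary part, to bring the real mean value theorem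
    to bear on a complex function along a segment. *)
Lemma comp_line_derive (r : R[i] -> R) f (m a d : R[i]) (t : R) :
  {morph r : x y / x - y} -> (forall x (s : R), r (x * s%:C) = r x * s) ->
  (forall x, `|r x| <= normc x) ->
  cderiv f (a + t%:C * d) m ->
  is_derive t (1 : R) (fun s : R => r (f (a + s%:C * d))) (r (m * d)).
Proof.
move=> rB rZ rle fd; apply/is_derive1P => e e0.
have d1 : 0 < normc d + 1 by have := normc_ge0 d; lra.
have /fd[k k0 kP] : 0 < e / (normc d + 1) by rewrite divr_gt0.
apply/nbhs_norm0P; exists (k / (normc d + 1)) => /=; first by rewrite divr_gt0.
move=> s /=; rewrite ltr_pdivlMr// => sk.
rewrite -rB -rZ -rB; apply: le_trans (rle _) _.
have nsd : normc (s%:C * d) = `|s| * normc d by rewrite normcM normc_real.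
have {kP} := kP (s%:C * d).
rewrite nsd; have s0 := normr_ge0 s; have dd := normc_ge0 d.
move=> /(_ _)/le_trans; rewrite rmorphD mulrDl addrA -[m * d * _]mulrA [d * _]mulrC.
apply; first by apply: le_lt_trans sk; rewrite ler_wpM2l// lerDl.
by rewrite mulrAC ler_pdivrMr//; nra.
Qed.

(** The factor 2 comes from bounding real and imaginary parts separately. *)
Lemma cderiv_mean_value f df a b (M : R) :
  (forall t : R, 0 <= t <= 1 ->
     cderiv f (a + t%:C * (b - a)) (df (a + t%:C * (b - a))) /\
     normc (df (a + t%:C * (b - a))) <= M) ->
  normc (f b - f a) <= 2 * M * normc (b - a).
Proof.
move=> H; have key (r : R[i] -> R) : {morph r : x y / x - y} ->
    (forall x (s : R), r (x * s%:C) = r x * s) ->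
    (forall x, `|r x| <= normc x) -> `|r (f b - f a)| <= M * normc (b - a).
  move=> rB rZ rle.
  pose phi (s : R) := r (f (a + s%:C * (b - a))).
  have dphi (t : R) : 0 <= t <= 1 ->
      is_derive t (1 : R) phi (r (df (a + t%:C * (b - a)) * (b - a))).
    by move=> /H[ft _]; exact: (comp_line_derive rB rZ rle ft).
  have cphi : {within `[0, 1], continuous phi}%classic.
    apply: derivable_within_continuous => t; rewrite in_itv/= => /dphi[].
    by [].
  have [|t|c] := @MVT_segment R phi
    (fun t => r (df (a + t%:C * (b - a)) * (b - a))) 0 1 _ _ cphi.
  - exact: ler01.
  - by rewrite in_itv/= => /andP[t0 t1]; apply: dphi; rewrite !ltW.
  rewrite in_itv/= => /H[_ dM]; rewrite subr0 mulr1 /phi.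
  rewrite mul0r addr0 mul1r (addrC a) subrK -rB => ->.
  by apply: le_trans (rle _) _; rewrite normcM ler_wpM2r// normc_ge0.
apply: le_trans (normc_le_ReIm _) _.
rewrite -mulrA mulr2n mulrDl !mul1r; apply: lerD; apply: key.
- exact: ReB.
- by move=> [x y] s; simpc.
- by move=> x; have [] := normc_ge_abs x.
- exact: ImB.
- by move=> [x y] s; simpc.
- by move=> x; have [] := normc_ge_abs x.
Qed.

Definition cconvex (D : R[i] -> Prop) :=
  forall a b (t : R), D a -> D b -> 0 <= t <= 1 -> D (a + t%:C * (b - a)).

(** Two applications of the mean value inequality: to f' on the segment, and then to
    z |-> f(z) - f'(a) z. *)
Lemma cderiv_taylor2 (D : R[i] -> Prop) f df ddf (M : R) :
  cconvex D -> (forall z, D z -> cderiv f z (df z)) ->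
  (forall z, D z -> cderiv df z (ddf z) /\ normc (ddf z) <= M) ->
  forall a b, D a -> D b ->
  normc (f b - f a - df a * (b - a)) <= 4 * M * normc (b - a) ^+ 2.
Proof.
move=> cD fdf dfddf a b Da Db.
have M0 : 0 <= M by apply: le_trans (proj2 (dfddf _ Da)); exact: normc_ge0.
have Dt (t : R) : 0 <= t <= 1 -> D (a + t%:C * (b - a)) by exact: cD.
have -> : f b - f a - df a * (b - a) = (f b - df a * b) - (f a - df a * a) by ring.
have -> : 4 * M * normc (b - a) ^+ 2 = 2 * (2 * M * normc (b - a)) * normc (b - a).
  by rewrite expr2; ring.
apply: (@cderiv_mean_value (fun z => f z - df a * z) (fun z => df z - df a)).
move=> t t01; split.
  apply: cderivB; first exact/fdf/Dt.
  by apply: cderiv_eq (cderivZ _ (cderiv_id _)) _; rewrite mulr1.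
have Dw := Dt t t01; set w := a + _ in Dw *.
have wE : w - a = t%:C * (b - a) by rewrite /w; ring.
apply: le_trans (@cderiv_mean_value df ddf a w M _) _.
  by move=> s s01; apply: dfddf; exact: cD.
rewrite -mulrA -[leRHS]mulrA ler_wpM2l// ler_wpM2l// wE normcM normc_real.
have /andP[t0 t1] := t01.
by rewrite ger0_norm// ler_piMl// normc_ge0.
Qed.

End ComplexCalculus.

(** * Germs of differentiable functions and iterated derivatives *)

Section GermSmooth.
Variable K : numFieldType.
Implicit Types (f g : K -> K) (a c z : K).

(** Differentiability j times in a neighbourhood of a.  Carrying the derivatives as
    witnesses makes closure under sums and products a plain induction. *)
Fixpoint germ_smooth (j : nat) f a : Prop :=
  if j is j'.+1 then
    exists2 g, (\forall z \near a, is_derive z (1 : K) f (g z)) & germ_smooth j' g a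
  else True.

Lemma germ_smooth_near_eq j f g a :
  (\forall z \near a, f z = g z) -> germ_smooth j f a -> germ_smooth j g a.
Proof.
case: j => // j fg [h fh hj]; exists h => //.
have fg2 := near_join fg; near=> z.
by apply: near_eq_is_derive; [near: z; exact: fg2|near: z; exact: fh].
Unshelve. all: by end_near. Qed.

Lemma germ_smoothW j f a : germ_smooth j.+1 f a -> germ_smooth j f a.
Proof. by elim: j f => // j IH f [g fg /IH gj]; exists g. Qed.

Lemma germ_smoothD j f g a : germ_smooth j f a -> germ_smooth j g a ->
  germ_smooth j (fun z => f z + g z) a.
Proof.
elim: j f g => // j IH f g [df fd dfj] [dg gd dgj].
exists (fun z => df z + dg z); last exact: IH.
by near=> z; apply: is_deriveD; near: z.
Unshelve. all: by end_near. Qed.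

Lemma germ_smoothM j f g a : germ_smooth j f a -> germ_smooth j g a ->
  germ_smooth j (fun z => f z * g z) a.
Proof.
elim: j f g => // j IH f g fj gj.
have [df fd dfj] := fj; have [dg gd dgj] := gj.
exists (fun z => f z * dg z + g z * df z).
  by near=> z; apply: is_deriveM; near: z.
by apply: germ_smoothD; apply: IH => //; exact: germ_smoothW.
Unshelve. all: by end_near. Qed.

Lemma near_addr (P : K -> Prop) a c :
  (\forall z \near a + c, P z) -> \forall z \near a, P (z + c).
Proof.
rewrite (pseudometric_normed_Zmodule.near_shift a).
by apply: filterS => z /=; rewrite [a + c]addrC addrK.
Qed.

Lemma is_derive_comp_shift f z c l : is_derive (z + c) (1 : K) f l ->
  is_derive z (1 : K) (fun w => f (w + c)) l.
Proof.
move=> /is_derive1P fl; apply/is_derive1P => e /fl.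
by apply: filterS => h; rewrite (addrAC z h).
Qed.

Lemma germ_smooth_shift j f a c : germ_smooth j f (a + c) ->
  germ_smooth j (fun z => f (z + c)) a.
Proof.
elim: j f => // j IH f [g fg gj]; exists (fun z => g (z + c)); last exact: IH.
by have := near_addr fg; apply: filterS => z; exact: is_derive_comp_shift.
Qed.

Lemma derive1n_comp_shift j f a c :
  derive1n j (fun z => f (z + c)) a = derive1n j f (a + c).
Proof.
elim: j f a => // j IH f a; rewrite !derive1Sn -IH; congr (derive1n j _ a).
apply/funext => z; rewrite /derive1.
by under eq_fun do rewrite -addrA.
Qed.

Lemma derive1n_near_eq j f g a : (\forall z \near a, f z = g z) ->
  \forall z \near a, derive1n j f z = derive1n j g z.
Proof.
elim: j f g => // j IH f g fg; rewrite !derive1Sn; apply: IH.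
have fg2 := near_join fg; near=> z.
by rewrite !derive1E; apply: near_eq_derive; near: z; exact: fg2.
Unshelve. all: by end_near. Qed.

Lemma germ_smooth_derivable j i f a : (i < j)%N -> germ_smooth j f a ->
  \forall z \near a, derivable (derive1n i f) z (1 : K).
Proof.
elim: i j f => [|i IH] [//|j] f ij [g fg gj].
  by apply: filterS fg => z [].
rewrite derive1Sn; apply: (IH j) => //; apply: germ_smooth_near_eq gj.
near=> z; rewrite derive1E; apply/esym; apply: derive_val.
by near: z; exact: fg.
Unshelve. all: by end_near. Qed.

(** Leibniz' rule for z |-> z f(z), the right-hand side of the functional equation
    of Gamma.  For i = 0 the predecessor is harmless, its factor being 0. *)
Lemma derive1n_idM j i f a : (i <= j)%N -> germ_smooth j f a ->
  \forall z \near a, derive1n i (fun z => z * f z) z =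
    z * derive1n i f z + i%:R * derive1n i.-1 f z.
Proof.
move=> + fj; elim: i => [|i IH] ij.
  by near=> z; rewrite mul0r addr0.
have id1 (k : nat) : (k < j)%N -> \forall z \near a,
    is_derive z (1 : K) (derive1n k f) (derive1n k.+1 f z).
  move=> kj; have := germ_smooth_derivable kj fj; apply: filterS => z dz.
  by rewrite derive1nS derive1E; exact: derivableP.
have H0 := id1 _ ij.
have H1 : \forall z \near a, is_derive z (1 : K)
    (fun z => i%:R * derive1n i.-1 f z) (i%:R * derive1n i f z).
  case: i {IH} ij {H0} => [|i] ij.
    near=> z; rewrite mul0r; under eq_fun do rewrite mul0r.
    exact: is_derive_cst.
  have := id1 _ (ltnW ij); apply: filterS => z dz; exact: (is_deriveZ (i.+1%:R : K)).
have IH2 := near_join (IH (ltnW ij)).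
near=> z; rewrite derive1nS derive1E.
rewrite (near_eq_derive _ (near IH2 z _))//.
have D0 : is_derive z (1 : K) (derive1n i f) (derive1n i.+1 f z) by near: z.
have D1 : is_derive z (1 : K) (fun z => i%:R * derive1n i.-1 f z) (i%:R * derive1n i f z).
  by near: z.
have := is_deriveD (is_deriveM (is_derive_id z (1 : K)) D0) D1.
move=> /@derive_val ->; rewrite /GRing.scale/=; ring.
Unshelve. all: by end_near. Qed.

End GermSmooth.

(** * Limits of sequences with uniformly bounded derivatives *)

Section TameSequences.
Variable R : realType.
Implicit Types (z w h a : R[i]) (F G : nat -> R[i] -> R[i]).

(** Uniformity in n on the half-discs Re z > 1, |z| <= r, which are convex and exhaust
    the half-plane. *)
Definition locally_bounded F := forall r : R, exists M : R, forall n z,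
  1 < complex.Re z -> normc z <= r -> normc (F n z) <= M.

Fixpoint tame (j : nat) F : Prop :=
  locally_bounded F /\
  if j is j'.+1 then
    exists2 G, (forall n z, 1 < complex.Re z -> cderiv (F n) z (G n z)) & tame j' G
  else True.

Lemma tame_bounded j F : tame j F -> locally_bounded F.
Proof. by case: j => [|j] []. Qed.

Lemma tameW j F : tame j.+1 F -> tame j F.
Proof.
elim: j F => [|j IH] F [bF [G FG Gj]]; split=> //.
by exists G => //; exact: IH.
Qed.

Lemma locally_boundedD F G : locally_bounded F -> locally_bounded G ->
  locally_bounded (fun n z => F n z + G n z).
Proof.
move=> bF bG r; have [M MP] := bF r; have [L LP] := bG r.
exists (M + L) => n z z1 zr; apply: le_trans (le_normcD _ _) _.
by apply: lerD; [exact: MP|exact: LP].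
Qed.

Lemma tameD j F G : tame j F -> tame j G -> tame j (fun n z => F n z + G n z).
Proof.
elim: j F G => [|j IH] F G Fj Gj; split => //;
  try by apply: locally_boundedD; apply: tame_bounded; eassumption.
have [_ [F' FF' Fj']] := Fj; have [_ [G' GG' Gj']] := Gj.
exists (fun n z => F' n z + G' n z); last exact: IH.
by move=> n z z1; apply: cderivD; [exact: FF'|exact: GG'].
Qed.

Lemma locally_boundedM F G : locally_bounded F -> locally_bounded G ->
  locally_bounded (fun n z => F n z * G n z).
Proof.
move=> bF bG r; have [M MP] := bF r; have [L LP] := bG r.
exists (M * L) => n z z1 zr; rewrite normcM.
by apply: ler_pM; [exact: normc_ge0|exact: normc_ge0|exact: MP|exact: LP].
Qed.

Lemma tameM j F G : tame j F -> tame j G -> tame j (fun n z => F n z * G n z).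
Proof.
elim: j F G => [|j IH] F G Fj Gj; split => //;
  try by apply: locally_boundedM; apply: tame_bounded; eassumption.
have [_ [F' FF' Fj']] := Fj; have [_ [G' GG' Gj']] := Gj.
exists (fun n z => F' n z * G n z + F n z * G' n z).
  by move=> n z z1; apply: cderivM; [exact: FF'|exact: GG'].
by apply: tameD; apply: IH => //; exact: tameW.
Qed.

Lemma cconvex_halfdisc (r : R) :
  cconvex (fun z => 1 < complex.Re z /\ normc z <= r).
Proof.
move=> a b t [a1 ar] [b1 br] /andP[t0 t1].
have -> : a + t%:C * (b - a) = (1 - t)%:C * a + t%:C * b.
  by rewrite rmorphB rmorph1; ring.
split.
  move: a b a1 ar b1 br => [a1 a2] [b1 b2] /= la _ lb _.
  have lm : 1 < Num.min a1 b1 by rewrite lt_min la lb.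
  have ma : Num.min a1 b1 <= a1 by rewrite ge_min lexx.
  have mb : Num.min a1 b1 <= b1 by rewrite ge_min lexx orbT.
  by apply: lt_le_trans lm _; nra.
apply: le_trans (le_normcD _ _) _; rewrite !normcM !normc_real.
rewrite ger0_norm ?subr_ge0// ger0_norm//.
by nra.
Qed.

(** The point is that M and d do not depend on n. *)
Lemma tame_taylor2 F F1 F2 a :
  (forall n z, 1 < complex.Re z -> cderiv (F n) z (F1 n z)) ->
  (forall n z, 1 < complex.Re z -> cderiv (F1 n) z (F2 n z)) ->
  locally_bounded F2 -> 1 < complex.Re a ->
  exists M d : R, [/\ 0 <= M, 0 < d & forall h, normc h <= d ->
    1 < complex.Re (a + h) /\
    forall n, normc (F n (a + h) - F n a - F1 n a * h) <= M * normc h ^+ 2].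
Proof.
move=> D1 D2 bF2 a1.
have [M MP] := bF2 (normc a + 1).
have a1n : normc a <= normc a + 1 by rewrite lerDl.
have M0 : 0 <= M by apply: le_trans (MP 0%N a a1 a1n); exact: normc_ge0.
exists (4 * M), (Num.min 1 ((complex.Re a - 1) / 2)); split.
- by rewrite mulr_ge0.
- by rewrite lt_min ltr01 /=; lra.
move=> h; rewrite le_min => /andP[h1 h2].
have ah1 : 1 < complex.Re (a + h).
  have [+ _] := normc_ge_abs h; rewrite ler_norml => /andP[+ _].
  by rewrite ReD; lra.
have ahr : normc (a + h) <= normc a + 1.
  by apply: le_trans (le_normcD _ _) _; rewrite lerD2l.
split=> // n.
have {2 3}-> : h = a + h - a by rewrite addrC addKr.
apply: (cderiv_taylor2 (@cconvex_halfdisc (normc a + 1)) (ddf := F2 n)) => //.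
- by move=> z [z1 _]; exact: D1.
- by move=> z [z1 zr]; split; [exact: D2|exact: MP].
Qed.

(** By the uniform Taylor estimate, F1 n a differs from the difference quotient
    (F n (a + h) - F n a) / h by at most M |h|.  The quotients converge for each fixed
    h, so F1 n a is a Cauchy sequence; passing to the limit in the Taylor estimate
    shows that its limit is the derivative of f. *)
Lemma tame_limit_derivative F F1 F2 (f : R[i] -> R[i]) :
  (forall n z, 1 < complex.Re z -> cderiv (F n) z (F1 n z)) ->
  (forall n z, 1 < complex.Re z -> cderiv (F1 n) z (F2 n z)) ->
  locally_bounded F2 ->
  (forall z, 1 < complex.Re z -> F ^~ z @ \oo --> (f z : R[i]^o)) ->
  exists f1 : R[i] -> R[i], forall z, 1 < complex.Re z ->
    cderiv f z (f1 z) /\ (F1 ^~ z @ \oo --> (f1 z : R[i]^o)).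
Proof.
move=> D1 D2 bF2 Ff.
suff /choice[f1 f1P] : forall z, exists l, 1 < complex.Re z ->
    cderiv f z l /\ (F1 ^~ z @ \oo --> (l : R[i]^o)) by exists f1.
move=> a; have [a1|/negP na1] := boolP (1 < complex.Re a); last by exists 0.
have [M [d [M0 d0 dP]]] := tame_taylor2 D1 D2 bF2 a1.
(* The step t is small enough for the two Taylor errors, of size M t^2 each, to use up
   at most half of e t. *)
have F1c : exists l : R[i], F1 ^~ a @ \oo --> (l : R[i]^o).
  apply: normc_cauchy_cvg => e e0.
  pose t := Num.min d (e / (4 * (M + 1))).
  have t0 : 0 < t by rewrite lt_min d0 divr_gt0// mulr_gt0//; lra.
  have tM : t * (4 * (M + 1)) <= e.
    by rewrite -ler_pdivlMr ?ge_min ?lexx ?orbT// mulr_gt0//; lra.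
  have nt : normc (t%:C) = t by rewrite normc_real ger0_norm// ltW.
  have [|at1 tay] := dP t%:C; first by rewrite nt ge_min lexx.
  have te : 0 < t * e / 8 by rewrite divr_gt0// mulr_gt0.
  have /cvg_normcP/(_ _ te) := Ff _ a1; have /cvg_normcP/(_ _ te) := Ff _ at1.
  move=> [N1 _ N1P] [N2 _ N2P]; exists (maxn N1 N2) => m n.
  rewrite !geq_max => /andP[m1 m2] /andP[n1 n2].
  rewrite -(ler_pM2r t0) -{1}nt -normcM.
  have -> : (F1 m a - F1 n a) * t%:C =
    (F n (a + t%:C) - F n a - F1 n a * t%:C)
    - (F m (a + t%:C) - F m a - F1 m a * t%:C)
    + ((F m (a + t%:C) - f (a + t%:C)) - (F n (a + t%:C) - f (a + t%:C)))
    - ((F m a - f a) - (F n a - f a)) by ring.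
  have A1 := tay n; have A2 := tay m; rewrite nt in A1 A2.
  have A3 := N1P _ m1; have A4 := N1P _ n1; have A5 := N2P _ m2; have A6 := N2P _ n2.
  apply: le_trans (normcB _ _) _; apply: le_trans (lerD (le_normcD _ _) (normcB _ _)) _.
  apply: le_trans (lerD (lerD (normcB _ _) (normcB _ _)) (lexx _)) _.
  have : M * t ^+ 2 <= e * t / 4.
    have := ler_wpM2l (ltW t0) tM; have := sqr_ge0 t; lra.
  by move: A1 A2 A3 A4 A5 A6 => /=; lra.
have [l lP] := F1c; exists l => _; split=> //.
have key h : normc h <= d -> normc (f (a + h) - f a - l * h) <= M * normc h ^+ 2.
  move=> hd; have [ah1 tay] := dP h hd.
  apply/ler_addgt0Pr => e e0.
  have h2 : 0 < normc h + 2 by have := normc_ge0 h; lra.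
  have eh : 0 < e / (normc h + 2) by rewrite divr_gt0.
  have /cvg_normcP/(_ _ eh) B1 := Ff _ a1; have /cvg_normcP/(_ _ eh) B2 := Ff _ ah1.
  have /cvg_normcP/(_ _ eh) B3 := lP.
  near \oo => n.
  have -> : f (a + h) - f a - l * h = (F n (a + h) - F n a - F1 n a * h)
    + (((F n a - f a) - (F n (a + h) - f (a + h))) + (F1 n a - l) * h) by ring.
  apply: le_trans (le_normcD _ _) _; apply: lerD; first exact: tay.
  apply: le_trans (le_normcD _ _) _; rewrite normcM.
  have -> : e = (e / (normc h + 2) + e / (normc h + 2)) + e / (normc h + 2) * normc h.
    by field; lra.
  apply: lerD; first apply: le_trans (normcB _ _) _; first apply: lerD.
  - by near: n.
  - by near: n.
  - by rewrite ler_wpM2r ?normc_ge0//; near: n.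
move=> e e0; have M1 : 0 < M + 1 by lra.
exists (Num.min d (e / (M + 1))) => [|h]; first by rewrite lt_min d0 divr_gt0.
rewrite lt_min => /andP[hd he]; apply: le_trans (key h (ltW hd)) _.
rewrite expr2 mulrA ler_wpM2r ?normc_ge0//.
move: he; rewrite ltr_pdivlMr//; have := normc_ge0 h; nra.
Unshelve. all: by end_near. Qed.

Lemma near_Re_gt (x : R) a : x < complex.Re a ->
  \forall z \near (a : (R[i] : numFieldType)), x < complex.Re z.
Proof.
move=> xa; have d0 : 0 < complex.Re a - x by rewrite subr_gt0.
apply/nbhs_normP; exists (complex.Re a - x)%:C => /=; first by rewrite ltcR.
move=> z /=; rewrite normr_normc ltcR => az.
have [+ _] := normc_ge_abs (a - z); rewrite ReB => /(le_trans (ler_norm _)).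
by lra.
Qed.

Lemma tame_limit_smooth j F (f : R[i] -> R[i]) a :
  tame j.+1 F -> (forall z, 1 < complex.Re z -> F ^~ z @ \oo --> (f z : R[i]^o)) ->
  1 < complex.Re a -> @germ_smooth (R[i] : numFieldType) j f a.
Proof.
elim: j F f => // j IH F f [_ [F1 D1 F1j]] Ff a1.
have [_ [F2 D2 F2j]] := F1j.
have [f1 f1P] := tame_limit_derivative D1 D2 (tame_bounded F2j) Ff.
exists f1.
  apply: filterS (near_Re_gt a1) => z z1; apply/cderivP.
  by have [] := f1P z z1.
exact: (IH F1 f1 F1j (fun z Uz => proj2 (f1P z Uz)) a1).
Qed.

End TameSequences.

(** * The complex exponential *)

Section ComplexExponential.
Variable R : realType.
Implicit Types (z w h c : R[i]) (x y e : R).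

Lemma CexpD z w : Cexp (z + w) = Cexp z * Cexp w.
Proof.
case: z w => [a b] [c d]; rewrite /Cexp /= expRD sinD cosD.
by simpc; congr (_ +i* _); ring.
Qed.

Lemma Cexp_real x : Cexp x%:C = (expR x)%:C.
Proof. by rewrite /Cexp /= cos0 sin0 [_ * _]mulr1. Qed.

Lemma Cexp0 : Cexp (0 : R[i]) = 1.
Proof. by rewrite (Cexp_real 0) expR0. Qed.

Lemma normc_Cexp z : normc (Cexp z) = expR (complex.Re z).
Proof.
rewrite /Cexp normcM normc_real ger0_norm ?expR_ge0// /normc.
by rewrite cos2Dsin2 sqrtr1 mulr1.
Qed.

Lemma real_near0_bound (f : R -> R) (l e : R) : is_derive 0 (1 : R) f l -> 0 < e ->
  exists2 d : R, 0 < d & forall x, `|x| < d -> `|f x - f 0 - l * x| <= e * `|x|.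
Proof.
move=> /is_derive1P H e0; have /nbhs_norm0P[/= d d0 dP] := H e e0.
by exists d => // x /dP /=; rewrite add0r.
Qed.

(** Only the first order behaviour of exp, cos and sin at 0 is used; the addition
    formula does the rest. *)
Lemma cderiv_Cexp0 : cderiv (@Cexp R) 0 1.
Proof.
move=> e e0; have [m [m0 m1 me]] : exists m : R, [/\ 0 < m, m <= 1 & 7 * m <= e].
  exists (Num.min 1 (e / 7)); split; first by rewrite lt_min ltr01 divr_gt0.
    by rewrite ge_min lexx.
  by rewrite mulrC -ler_pdivlMr// ge_min lexx orbT.
have /(real_near0_bound)/(_ m0)[d1 d10 P1] := is_derive_expR (0 : R).
have /(real_near0_bound)/(_ m0)[d2 d20 P2] := is_derive_cos (0 : R).
have /(real_near0_bound)/(_ m0)[d3 d30 P3] := is_derive_sin (0 : R).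
exists (Num.min (Num.min d1 d2) (Num.min d3 (Num.min m (1 / 2)))) => [|h].
  by rewrite !lt_min d10 d20 d30 m0 divr_gt0.
(* With each first order error at most m |h|, and |x| < m, |x| < 1/2, the total error
   is at most 7 m |h|. *)
rewrite !lt_min => /andP[/andP[h1 h2] /andP[h3 /andP[hm hh]]].
have [xh yh] := normc_ge_abs h.
have {}P1 := P1 _ (le_lt_trans xh h1).
have {}P2 := P2 _ (le_lt_trans yh h2).
have {}P3 := P3 _ (le_lt_trans yh h3).
have {}hm := le_lt_trans xh hm; have {}hh := le_lt_trans xh hh.
rewrite expR0 mul1r in P1; rewrite cos0 sin0 oppr0 mul0r subr0 in P2.
rewrite sin0 cos0 subr0 mul1r in P3.
rewrite add0r Cexp0 mul1r; apply: le_trans (normc_le_ReIm _) _.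
move: (normc h) xh yh {h1 h2 h3} => nh xh yh.
case: h xh yh hm hh P1 P2 P3 => x y /=; rewrite !mul0r subr0 addr0 => xh yh hm hh P1 P2 P3.
set E := expR x in P1 *; set c := cos y in P2 *; set s := sin y in P3 *.
have x0 := normr_ge0 x; have y0 := normr_ge0 y.
have E2 : `|E| <= 2.
  have -> : E = (E - 1 - x) + (1 + x) by ring.
  apply: le_trans (ler_normD _ _) _; have := ler_normD 1 x; rewrite normr1; nra.
have A1 : `|E * c - 1 - x| <= 2 * (m * `|y|) + m * `|x|.
  have -> : E * c - 1 - x = E * (c - 1) + (E - 1 - x) by ring.
  apply: le_trans (ler_normD _ _) _; apply: lerD => //.
  by rewrite normrM; apply: ler_pM.
have A2 : `|E * s - 0 - y| <= 2 * (m * `|y|) + (m * `|x| + `|x|) * `|y|.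
  have -> : E * s - 0 - y = E * (s - y) + ((E - 1 - x) + x) * y by ring.
  apply: le_trans (ler_normD _ _) _; rewrite !normrM; apply: lerD.
    by apply: ler_pM.
  apply: ler_wpM2r => //; apply: le_trans (ler_normD _ _) _; exact: lerD.
have A3 : (m * `|x| + `|x|) * `|y| <= 2 * m * `|y|.
  by apply: ler_wpM2r => //; nra.
have [A4 A5] : m * `|x| <= m * nh /\ m * `|y| <= m * nh.
  by split; rewrite ler_wpM2l// ltW.
apply: le_trans (lerD A1 A2) _.
have : 7 * m * nh <= e * nh by apply: ler_wpM2r => //; exact: le_trans xh.
lra.
Qed.

Lemma cderiv_Cexp c z : cderiv (fun w => Cexp (w * c)) z (c * Cexp (z * c)).
Proof.
move=> e e0; set E := normc (Cexp (z * c)).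
have E0 : 0 <= E := normc_ge0 _; have c0 := normc_ge0 c.
have k0 : 0 < (normc c + 1) * (E + 1) by rewrite mulr_gt0//; lra.
have c1 : 0 < normc c + 1 by lra.
have [d d0 dP] := cderiv_Cexp0 (divr_gt0 e0 k0).
exists (d / (normc c + 1)) => [|h]; first by rewrite divr_gt0.
rewrite ltr_pdivlMr// => hd; have h0 := normc_ge0 h.
have -> : Cexp ((z + h) * c) - Cexp (z * c) - c * Cexp (z * c) * h
        = Cexp (z * c) * (Cexp (0 + h * c) - Cexp 0 - 1 * (h * c)).
  by rewrite mulrDl CexpD add0r Cexp0; ring.
rewrite normcM -/E.
have hcd : normc (h * c) < d by rewrite normcM; nra.
have := dP _ hcd; rewrite mulrAC ler_pdivlMr// normcM => X.
have Y := normc_ge0 (Cexp (0 + h * c) - Cexp 0 - 1 * (h * c)).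
move: (normc (_ - _)) X Y => q X Y.
have e1 : e * (normc h * normc c) <= e * normc h * (normc c + 1).
  by rewrite mulrA ler_wpM2l ?lerDl// mulr_ge0// ltW.
have : q * (E + 1) * (normc c + 1) <= e * normc h * (normc c + 1).
  by apply: le_trans e1; rewrite -mulrA [(E + 1) * _]mulrC.
rewrite ler_pM2r// => X2; apply: le_trans X2.
by rewrite mulrC ler_wpM2l// lerDl.
Qed.

Lemma Cexp_taylor2 w :
  normc (Cexp w - 1 - w) <= 4 * expR (normc w) * normc w ^+ 2.
Proof.
have cE z : cderiv (@Cexp R) z (Cexp z).
  have := cderiv_Cexp 1 z; rewrite mulr1 mul1r.
  by under eq_fun do rewrite mulr1.
have cD : cconvex (fun z => normc z <= normc w).
  move=> a b t aw bw /andP[t0 t1].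
  have -> : a + t%:C * (b - a) = (1 - t)%:C * a + t%:C * b.
    by rewrite rmorphB rmorph1; ring.
  apply: le_trans (le_normcD _ _) _; rewrite !normcM !normc_real.
  by rewrite ger0_norm ?subr_ge0// ger0_norm//; nra.
have := @cderiv_taylor2 R _ _ _ (@Cexp R) (expR (normc w)) cD (fun z _ => cE z) _ 0 w.
rewrite Cexp0 mul1r subr0; apply.
- move=> z zw; split=> //; rewrite normc_Cexp ler_expR; apply: le_trans zw.
  by have [+ _] := normc_ge_abs z; apply: le_trans; exact: ler_norm.
- by rewrite normc0 normc_ge0.
- exact: lexx.
Qed.

End ComplexExponential.

(** * Euler's sequence for Gamma and its logarithmic derivative *)

Section GammaSequence.
Variable R : realType.
Implicit Types (z w a : R[i]).

Definition gamma_seq (n : nat) z : R[i] :=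
  n`!%:R * Cexp (z * (ln n%:R)%:C) / \prod_(0 <= k < n.+1) (z + k%:R).

(** Partial sums of the Hurwitz zeta function at the integer i. *)
Definition zeta_sum (i n : nat) z : R[i] :=
  \sum_(k < n) (z + k%:R)^-1 ^+ i.

(** The logarithmic derivative of [gamma_seq n]; it tends to the digamma function. *)
Definition psi_seq (n : nat) z : R[i] := (ln n%:R)%:C - zeta_sum 1 n.+1 z.

Lemma normc_addn_ge (k : nat) z : 1 < complex.Re z -> k.+1%:R <= normc (z + k%:R).
Proof.
move=> z1; have [+ _] := normc_ge_abs (z + k%:R); apply: le_trans.
apply: le_trans (ler_norm _); rewrite ReD.
have -> : complex.Re (k%:R : R[i]) = k%:R by rewrite -(rmorph_nat (real_complex R)).
by rewrite -natr1; lra.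
Qed.

Lemma addn_neq0 (k : nat) z : 1 < complex.Re z -> z + k%:R != 0.
Proof.
by move=> /(normc_addn_ge k) h; rewrite -normc_gt0; apply: lt_le_trans h; rewrite ltr0n.
Qed.

(** Compare with the telescoping sum of 1/k - 1/(k + 1). *)
Lemma sum_inv_sqr_le (n : nat) :
  \sum_(k < n) (k.+1%:R ^- 2 : R) <= 2.
Proof.
suff H m : \sum_(k < m.+1) (k.+1%:R ^- 2 : R) <= 2 - m.+1%:R^-1.
  case: n => [|m]; first by rewrite big_ord0.
  by apply: le_trans (H m) _; rewrite gerBl.
elim: m => [|m IH].
  by rewrite big_ord1 mulr1n expr1n invr1; lra.
rewrite big_ord_recr /=; apply: le_trans (lerD IH (lexx _)) _.
have : (m.+2%:R ^- 2 : R) <= m.+1%:R^-1 - m.+2%:R^-1.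
  2: by move=> H; apply: le_trans (lerD (lexx _) H) _; rewrite addrA subrK.
have -> : (m.+1%:R^-1 - m.+2%:R^-1 : R) = (m.+2%:R * m.+1%:R)^-1.
  have : (0 : R) < m.+1%:R by rewrite ltr0n.
  rewrite -(natr1 m.+1); move: (m.+1%:R : R) => x x0; field.
  by rewrite !gt_eqF//; lra.
rewrite lef_pV2 ?posrE ?mulr_gt0 ?exprn_gt0 ?ltr0n//.
by rewrite expr2 ler_wpM2l// ler_nat.
Qed.

Lemma cderiv_inv_pow (i : nat) (c : R[i]) z : z + c != 0 ->
  cderiv (fun w => (w + c)^-1 ^+ i) z (- i%:R * (z + c)^-1 ^+ i.+1).
Proof.
move=> zc; elim: i => [|i IH].
  rewrite oppr0 mul0r; exact: cderiv_cst.
have := cderivM (cderivV zc) IH.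
have -> : (fun w => (w + c)^-1 * (w + c)^-1 ^+ i) = (fun w => (w + c)^-1 ^+ i.+1).
  by apply/funext => w; rewrite exprS.
move=> H; apply: cderiv_eq H _.
by rewrite -natr1 -exprVn !exprS; ring.
Qed.

Lemma cderiv_zeta_sum i n z : 1 < complex.Re z ->
  cderiv (zeta_sum i n) z (- i%:R * zeta_sum i.+1 n z).
Proof.
move=> z1; rewrite /zeta_sum mulr_sumr.
apply: (@cderiv_sum _ (fun k w => (w + k%:R)^-1 ^+ i)
  (fun k w => - i%:R * (w + k%:R)^-1 ^+ i.+1)) => k.
exact/cderiv_inv_pow/addn_neq0.
Qed.

Lemma normcX z n : normc (z ^+ n) = normc z ^+ n.
Proof. by elim: n => [|n IH]; rewrite ?normc1// !exprS normcM IH. Qed.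

Lemma normc_sum_le (F : nat -> R[i]) n :
  normc (\sum_(k < n) F k) <= \sum_(k < n) normc (F k).
Proof.
elim: n => [|n IH]; first by rewrite !big_ord0 normc0.
by rewrite !big_ord_recr /=; apply: le_trans (le_normcD _ _) _; rewrite lerD2r.
Qed.

Lemma normc_invn_le (k : nat) z : 1 < complex.Re z ->
  normc (z + k%:R)^-1 <= k.+1%:R^-1.
Proof.
move=> z1; rewrite normcV lef_pV2 ?posrE ?ltr0n// ?normc_gt0 ?addn_neq0//.
exact: normc_addn_ge.
Qed.

(** On Re z > 1 one has |z + k| >= k + 1, so exponents at least 2 give a bound by the
    series of inverse squares. *)
Lemma locally_bounded_zeta_sum i (s : nat -> nat) :
  locally_bounded (fun n z => zeta_sum i.+2 (s n) z).
Proof.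
move=> r; exists 2 => n z z1 _.
apply: le_trans (normc_sum_le (fun k => (z + k%:R)^-1 ^+ i.+2) _) _.
apply: (le_trans _ (sum_inv_sqr_le (s n))); apply: ler_sum => k _.
rewrite normcX; have := normc_invn_le k z1; have := normc_ge0 (z + k%:R)^-1.
move: (normc _) => q q0 qk.
have q1 : q <= 1 by apply: le_trans qk _; rewrite invf_le1 ?ltr0n// ler1n.
rewrite -exprVn -addn2 exprD; apply: le_trans (_ : 1 * q ^+ 2 <= _).
  by rewrite ler_wpM2r ?exprn_ge0// exprn_ile1.
by rewrite mul1r lerXn2r// nnegrE ?invr_ge0// ler0n.
Qed.

Lemma tame_cst j (c : R[i]) : tame j (fun _ _ => c).
Proof.
elim: j c => [|j IH] c; (split; first by move=> r; exists (normc c)) => //.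
by exists (fun _ _ => 0) => // n z _; exact: cderiv_cst.
Qed.

Lemma tame_zeta_sum j i (s : nat -> nat) :
  tame j (fun n z => zeta_sum i.+2 (s n) z).
Proof.
elim: j i => [|j IH] i; (split; first exact: locally_bounded_zeta_sum) => //.
exists (fun n z => - i.+2%:R * zeta_sum i.+3 (s n) z).
  by move=> n z; exact: cderiv_zeta_sum.
exact: (tameM (tame_cst j (- i.+2%:R)) (IH i.+1)).
Qed.

Lemma ln_step (n : nat) :
  n.+2%:R^-1 <= ln n.+2%:R - ln n.+1%:R :> R /\
  ln n.+2%:R - ln n.+1%:R <= n.+1%:R^-1 :> R.
Proof.
have p1 : (0 : R) < n.+1%:R by rewrite ltr0n.
have p2 : (0 : R) < n.+2%:R by rewrite ltr0n.
have v1 : (0 : R) < n.+1%:R^-1 by rewrite invr_gt0.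
split; last first.
  rewrite -ln_div ?posrE// -(natr1 n.+1) mulrDl divff ?gt_eqF// mul1r.
  by apply: le_ln1Dx; apply: lt_trans v1; rewrite ltrN10.
rewrite -lerN2 opprB -ln_div ?posrE//.
have -> : n.+1%:R / n.+2%:R = 1 + - n.+2%:R^-1 :> R.
  by apply: (mulIf (lt0r_neq0 p2)); rewrite mulfVK ?gt_eqF// mulrBl mulVf ?gt_eqF// mul1r -(natr1 n.+1) addrK.
by apply: le_ln1Dx; rewrite ltrN2 invf_lt1// ltr1n.
Qed.

(** The sequence converges to minus Euler's constant; a crude bound suffices. *)
Lemma ln_harmonic_bound (n : nat) :
  `|ln n.+1%:R - \sum_(k < n.+2) k.+1%:R^-1| <= 2 :> R.
Proof.
have lo m : ln m.+1%:R <= \sum_(k < m) k.+1%:R^-1 :> R.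
  elim: m => [|m IH]; first by rewrite big_ord0 ln1.
  rewrite big_ord_recr /=; have [_ H] := ln_step m.
  by rewrite -[leLHS](subrK (ln m.+1%:R)) addrC lerD.
have up m : \sum_(k < m.+2) k.+1%:R^-1 <= ln m.+1%:R + 2 :> R.
  elim: m => [|m IH].
    rewrite !big_ord_recr big_ord0 /= ln1 invr1 !add0r.
    have : (2%:R^-1 : R) <= 1 by rewrite invf_le1 ?ltr0n// ler1n.
    lra.
  rewrite big_ord_recr /=; have [H _] := ln_step m.
  have : (m.+3%:R^-1 : R) <= m.+2%:R^-1 by rewrite lef_pV2 ?posrE ?ltr0n// ler_nat.
  by move: IH H; move: (\sum_(k < _) _) (ln _) (ln _) (_^-1) (_^-1) => ? ? ? ? ?; lra.
have {}lo : ln n.+1%:R <= \sum_(k < n.+2) k.+1%:R^-1 :> R.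
  apply: le_trans (lo n) _; rewrite !big_ord_recr /= -addrA lerDl.
  by rewrite addr_ge0// invr_ge0 ler0n.
by rewrite ler_norml; have := up n; move: lo; lra.
Qed.

(** Subtracting the harmonic sum at z = 1 turns the divergent sum of the 1/(z + k) into
    a sum of terms (z - 1) / ((k + 1)(z + k)), again bounded by inverse squares.  The
    index starts at 1 because ln 0 is a dummy value. *)
Lemma locally_bounded_psi_seq : locally_bounded (fun n => psi_seq n.+1).
Proof.
move=> r; exists (2 + (r + 1) * 2) => n z z1 zr.
have -> : psi_seq n.+1 z =
    (ln n.+1%:R - \sum_(k < n.+2) k.+1%:R^-1)%:C
    + \sum_(k < n.+2) (k.+1%:R^-1 - (z + k%:R)^-1).
  rewrite sumrB rmorphB rmorph_sum /=.
  under [X in _ - X + _]eq_bigr do rewrite fmorphV rmorph_nat.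
  by rewrite /psi_seq /zeta_sum addrA subrK.
apply: le_trans (le_normcD _ _) _; rewrite normc_real.
apply: lerD; first exact: ln_harmonic_bound.
have r1 : 0 <= r + 1 by have := le_trans (normc_ge0 z) zr; lra.
apply: le_trans (normc_sum_le (fun k => k.+1%:R^-1 - (z + k%:R)^-1) _) _.
apply: le_trans (_ : (r + 1) * \sum_(k < n.+2) (k.+1%:R ^- 2 : R) <= _); last first.
  by rewrite ler_wpM2l// sum_inv_sqr_le.
rewrite mulr_sumr; apply: ler_sum => k _.
have -> : k.+1%:R^-1 - (z + k%:R)^-1 = (z - 1) * (k.+1%:R^-1 * (z + k%:R)^-1) :> R[i].
  have k0 : (k.+1%:R : R[i]) != 0 by rewrite pnatr_eq0.
  have := addn_neq0 k z1; move: k0; rewrite -natr1 => k0 zk0.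
  by field; rewrite k0 zk0.
rewrite normcM; apply: ler_pM; rewrite ?normc_ge0//.
  by apply: le_trans (normcB _ _) _; rewrite normc1 lerD2r.
rewrite normcM normcV normc_nat exprSr expr1 invfM ler_wpM2l ?invr_ge0 ?ler0n//.
exact: normc_invn_le.
Qed.

Lemma tame_psi_seq j : tame j (fun n => psi_seq n.+1).
Proof.
case: j => [|j]; (split; first exact: locally_bounded_psi_seq) => //.
exists (fun n => zeta_sum 2 n.+2); last exact: (tame_zeta_sum j 0 (fun n => n.+2)).
move=> n z z1; have := cderivB (cderiv_cst (ln n.+1%:R)%:C z) (@cderiv_zeta_sum 1 n.+2 z z1).
by move=> H; apply: cderiv_eq H _; rewrite sub0r mulN1r opprK.
Qed.

Lemma cderiv_gamma_seq n z : 1 < complex.Re z ->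
  cderiv (gamma_seq n) z (gamma_seq n z * psi_seq n z).
Proof.
move=> z1; pose Q m w : R[i] := \prod_(0 <= k < m) (w + k%:R)^-1.
have dQ m : cderiv (Q m) z (- Q m z * zeta_sum 1 m z).
  elim: m => [|m IH].
    rewrite /zeta_sum big_ord0 mulr0.
    have -> : Q 0%N = fun=> 1 by apply/funext => w; rewrite /Q big_nil.
    exact: cderiv_cst.
  have QS w : Q m.+1 w = Q m w * (w + m%:R)^-1 by rewrite /Q big_nat_recr.
  have -> : Q m.+1 = fun w => Q m w * (w + m%:R)^-1 by apply/funext.
  apply: cderiv_eq (cderivM IH (cderivV (addn_neq0 m z1))) _.
  rewrite /zeta_sum big_ord_recr /= -/(zeta_sum 1 m z) expr1 -exprVn expr2; ring.
have gE m w : gamma_seq m w = (m`!%:R * Cexp (w * (ln m%:R)%:C)) * Q m.+1 w.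
  by rewrite /gamma_seq /Q prodfV.
have -> : gamma_seq n = fun w => (n`!%:R * Cexp (w * (ln n%:R)%:C)) * Q n.+1 w.
  by apply/funext.
apply: cderiv_eq (cderivM (cderivZ _ (cderiv_Cexp _ _)) (dQ n.+1)) _.
by rewrite /psi_seq; ring.
Qed.

End GammaSequence.

(** * Convergence of Euler's sequence *)

Section GammaLimit.
Variable R : realType.
Implicit Types (z w a : R[i]).

(** With t := ln(1 + 1/N), N := n + 1, the ratio of consecutive terms is
    (N + 1) e^(z t) / (z + N + 1).  Its distance to 1 is made of the Taylor remainder of
    e^(z t) and of z ((N + 1) t - 1), both O(1/N^2) after division.  The bound is
    written as a difference so that its sum over n telescopes. *)
Lemma gamma_seq_ratio n z : 1 < complex.Re z ->
  normc (gamma_seq n.+2 z - gamma_seq n.+1 z) <=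
  normc (gamma_seq n.+1 z) *
    ((8 * expR (normc z) * normc z ^+ 2 + normc z) * (n.+1%:R^-1 - n.+2%:R^-1)).
Proof.
move=> z1; set r := normc z; set C := _ + r.
have r0 : 0 <= r := normc_ge0 z.
pose t : R := ln n.+2%:R - ln n.+1%:R.
have [t1 t2] := ln_step R n; rewrite -/t in t1 t2.
have p1 : (0 : R) < n.+1%:R by rewrite ltr0n.
have p2 : (0 : R) < n.+2%:R by rewrite ltr0n.
have p3 : (0 : R) <= n%:R by rewrite ler0n.
have t0 : 0 <= t by apply: le_trans t1; rewrite invr_ge0 ltW.
pose N : R := n.+1%:R.
have NE : n.+2%:R = N + 1 by rewrite natr1.
have N1 : 1 <= N by rewrite /N ler1n.
rewrite NE -/N in t1 t2 *; rewrite -/N in p1; clearbody N.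
have zn0 := addn_neq0 n.+2 z1.
have nb : N + 1 <= normc (z + n.+2%:R).
  rewrite -NE; apply: le_trans (normc_addn_ge n.+2 z1); by rewrite ler_nat.
have -> : gamma_seq n.+2 z - gamma_seq n.+1 z = gamma_seq n.+1 z *
   ((n.+2%:R * (Cexp (z * t%:C) - 1 - z * t%:C) + z * ((N + 1) * t - 1)%:C) / (z + n.+2%:R)).
  have -> : gamma_seq n.+2 z = gamma_seq n.+1 z * (n.+2%:R * Cexp (z * t%:C) / (z + n.+2%:R)).
    rewrite /gamma_seq [in LHS]factS natrM big_nat_recr//= invfM.
    have -> : z * (ln n.+2%:R)%:C = z * (ln n.+1%:R)%:C + z * t%:C.
      by rewrite -mulrDr -rmorphD /t addrC subrK.
    by rewrite CexpD; ring.
  rewrite -{2}[gamma_seq n.+1 z]mulr1 -mulrBr; congr (_ * _).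
  have -> : ((N + 1) * t - 1)%:C = n.+2%:R * t%:C - 1.
    by rewrite rmorphB rmorphM -NE rmorph_nat rmorph1.
  by move: (t%:C) (Cexp _) => T E; move: (n.+2%:R) zn0 => M zM; field.
rewrite normcM ler_wpM2l ?normc_ge0//.
rewrite normcM normcV ler_pdivrMr ?normc_gt0//.
have q0 : 0 < N * (N + 1) by rewrite mulr_gt0//; lra.
have E1 : N^-1 - (N + 1)^-1 = (N * (N + 1))^-1.
  by field; rewrite !gt_eqF//; lra.
have C0 : 0 <= C by rewrite addr_ge0// !mulr_ge0// ?expR_ge0// sqr_ge0.
rewrite E1; apply: le_trans (_ : C / N <= _); last first.
  rewrite -mulrA ler_wpM2l// mulrC ler_pdivlMr//.
  by rewrite mulrA mulVf ?gt_eqF// mul1r.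
apply: le_trans (le_normcD _ _) _; rewrite /C [leRHS]mulrDl; apply: lerD.
  rewrite normcM normc_nat NE.
  have nzt : normc (z * t%:C) = r * t by rewrite normcM normc_real ger0_norm.
  have tle1 : t <= 1 by apply: le_trans t2 _; rewrite invf_le1.
  have T := Cexp_taylor2 (z * t%:C); rewrite nzt in T.
  have e1 : expR (r * t) <= expR r by rewrite ler_expR ler_piMr.
  have e2 : (r * t) ^+ 2 <= r ^+ 2 * N ^- 2.
    by rewrite exprMn ler_wpM2l ?sqr_ge0// -exprVn lerXn2r// nnegrE ?invr_ge0 ?ltW.
  apply: le_trans (ler_wpM2l _ (le_trans T (ler_pM _ _ (ler_wpM2l _ e1) e2))) _ => //;
    rewrite ?sqr_ge0 ?mulr_ge0 ?expR_ge0//; first lra.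
  have -> : (N + 1) * (4 * expR r * (r ^+ 2 * N ^- 2)) =
            (4 * expR r * r ^+ 2 / N) * ((N + 1) / N).
    by field; rewrite gt_eqF.
  have -> : 8 * expR r * r ^+ 2 / N = (4 * expR r * r ^+ 2 / N) * 2 by ring.
  rewrite ler_wpM2l//; last by rewrite ler_pdivrMr//; lra.
  by rewrite !mulr_ge0// ?expR_ge0 ?sqr_ge0// invr_ge0 ltW.
rewrite normcM normc_real -/r ler_wpM2l// ler_norml; apply/andP; split.
  have : 1 <= (N + 1) * t by rewrite mulrC -ler_pdivrMr ?mul1r//; lra.
  have : 0 < N^-1 by rewrite invr_gt0.
  by lra.
have : (N + 1) * t <= (N + 1) * N^-1 by rewrite ler_wpM2l//; lra.
by rewrite [(N + 1) * N^-1]mulrDl divff ?gt_eqF// mul1r; lra.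
Qed.

(** From 1 + x <= e^x, the product of the factors 1 + C (1/(n+1) - 1/(n+2)) is at most
    the exponential of a telescoping sum. *)
Lemma small_increments_bound (u : nat -> R[i]) (C : R) : 0 <= C ->
  (forall n, normc (u n.+1 - u n) <= normc (u n) * (C * (n.+1%:R^-1 - n.+2%:R^-1))) ->
  forall n, normc (u n) <= normc (u 0%N) * expR C.
Proof.
move=> C0 uP n.
suff H m : normc (u m) <= normc (u 0%N) * expR (C * (1 - m.+1%:R^-1)).
  by apply: le_trans (H n) _; rewrite ler_wpM2l ?normc_ge0// ler_expR ler_piMr// gerBl.
elim: m => [|m IH]; first by rewrite invr1 subrr mulr0 expR0 mulr1.
have -> : u m.+1 = (u m.+1 - u m) + u m by rewrite subrK.
apply: le_trans (le_normcD _ _) _; apply: le_trans (lerD (uP m) (lexx _)) _.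
rewrite -{2}[normc (u m)]mulr1 -mulrDr.
apply: le_trans (_ : normc (u m) * expR (C * (m.+1%:R^-1 - m.+2%:R^-1)) <= _).
  by rewrite ler_wpM2l ?normc_ge0// addrC expR_ge1Dx.
apply: le_trans (ler_wpM2r (expR_ge0 _) IH) _.
by rewrite -mulrA -expRD -mulrDr addrA subrK.
Qed.

Lemma small_increments_cvg (u : nat -> R[i]) (C : R) : 0 <= C ->
  (forall n, normc (u n.+1 - u n) <= normc (u n) * (C * (n.+1%:R^-1 - n.+2%:R^-1))) ->
  exists l : R[i], u @ \oo --> (l : R[i]^o).
Proof.
move=> C0 uP; have bu := small_increments_bound C0 uP.
set B := normc (u 0%N) * expR C in bu.
have B0 : 0 <= B by rewrite mulr_ge0 ?normc_ge0 ?expR_ge0.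
have tele n k : normc (u (n + k)%N - u n) <= B * C * (n.+1%:R^-1 - (n + k).+1%:R^-1).
  elim: k => [|k IH]; first by rewrite addn0 !subrr normc0 mulr0.
  rewrite addnS; have -> : u (n + k).+1 - u n = (u (n + k).+1 - u (n + k)%N) + (u (n + k)%N - u n).
    by rewrite addrA subrK.
  apply: le_trans (le_normcD _ _) _; apply: le_trans (lerD (uP _) IH) _.
  apply: le_trans (lerD (ler_wpM2r _ (bu _)) (lexx _)) _.
    rewrite mulr_ge0// subr_ge0 lef_pV2 ?posrE ?ltr0n// ler_nat.
    exact: leqnSn.
  rewrite mulrA -mulrDr; apply: ler_wpM2l; first exact: mulr_ge0.
  by rewrite addrC addrA subrK.
have tele2 n k : (n <= k)%N -> normc (u k - u n) <= B * C * n.+1%:R^-1.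
  move=> /subnKC <-; apply: le_trans (tele _ _) _.
  by apply: ler_wpM2l; [exact: mulr_ge0|rewrite gerBl].
apply: normc_cauchy_cvg => e e0.
have [N NP] : exists N : nat, B * C * N.+1%:R^-1 <= e / 2.
  have e2 : 0 < e / 2 by rewrite divr_gt0.
  have /archi_boundP := divr_ge0 (mulr_ge0 B0 C0) (ltW e2).
  set m := Num.bound _ => mP; exists m; rewrite ler_pdivrMr ?ltr0n//.
  rewrite [leRHS]mulrC -ler_pdivrMr//; apply: ltW; apply: lt_le_trans mP _.
  by rewrite ler_nat.
exists N => m n Nm Nn.
have -> : u m - u n = (u m - u N) - (u n - u N) by ring.
apply: le_trans (normcB _ _) _; rewrite [e]splitr.
by apply: lerD; apply: le_trans NP; exact: tele2.
Qed.

End GammaLimit.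

(** * Gamma off its poles *)

Lemma cvg_mul3 (K : numFieldType) (u v : nat -> K) (a b c : K) :
  u @ \oo --> a -> v @ \oo --> b -> (fun n => u n * c * v n) @ \oo --> a * c * b.
Proof. by move=> ua vb; apply: cvgM vb; apply: cvgM ua (cvg_cst c). Qed.

Section GammaFunction.
Variable R : realType.
Implicit Types (z w a : R[i]).

Lemma gamma_seq1_le1 z : 1 < complex.Re z -> normc (gamma_seq 1 z) <= 1.
Proof.
move=> z1; rewrite /gamma_seq ln1 mulr0 Cexp0 mul1r div1r big_nat_recr//= big_nat1.
rewrite normcV normcM invf_le1.
  by rewrite mulr_ege1// (le_trans _ (normc_addn_ge _ z1))// ler1n.
by rewrite mulr_gt0// normc_gt0 addn_neq0.
Qed.

Lemma locally_bounded_gamma_seq : locally_bounded (fun n => @gamma_seq R n.+1).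
Proof.
move=> r; exists (expR (8 * expR r * r ^+ 2 + r)) => n z z1 zr.
have z0 := normc_ge0 z; have r0 := le_trans z0 zr.
set C := 8 * _ * _ + _; set D := 8 * expR (normc z) * normc z ^+ 2 + normc z.
have DC : D <= C.
  apply: lerD => //; apply: ler_pM; rewrite ?mulr_ge0 ?expR_ge0 ?sqr_ge0//.
    by rewrite ler_wpM2l// ler_expR.
  by rewrite lerXn2r// nnegrE.
have D0 : 0 <= D by rewrite addr_ge0// !mulr_ge0// ?expR_ge0// sqr_ge0.
have := small_increments_bound D0 (fun n => gamma_seq_ratio n z1) n.
move=> /le_trans; apply; rewrite -[leRHS]mul1r.
by apply: ler_pM; rewrite ?normc_ge0 ?expR_ge0 ?gamma_seq1_le1 ?ler_expR.
Qed.

(** Gamma_n' = psi_n Gamma_n, so a bound on j derivatives of Gamma_n gives a bound on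
    j + 1 of them. *)
Lemma tame_gamma_seq j : tame j (fun n => @gamma_seq R n.+1).
Proof.
elim: j => [|j IH]; (split; first exact: locally_bounded_gamma_seq) => //.
exists (fun n z => gamma_seq n.+1 z * psi_seq n.+1 z).
  by move=> n z; exact: cderiv_gamma_seq.
exact: tameM IH (tame_psi_seq R j).
Qed.

Lemma gamma_seq_cvgE z (l : R[i]) :
  @gamma_seq R ^~ z @ \oo --> (l : R[i]^o) -> Cgamma z = l.
Proof. by move=> zl; exact: (cvg_lim (@norm_hausdorff _ R[i]^o) zl). Qed.

Definition gamma_cvg z := @gamma_seq R ^~ z @ \oo --> (Cgamma z : R[i]^o).

Lemma gamma_cvg_halfplane z : 1 < complex.Re z -> gamma_cvg z.
Proof.
move=> z1; have C0 : 0 <= 8 * expR (normc z) * normc z ^+ 2 + normc z.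
  apply: addr_ge0; last exact: normc_ge0.
  by apply: mulr_ge0; rewrite ?sqr_ge0// mulr_ge0// expR_ge0.
have [l lP] := small_increments_cvg C0 (fun n => gamma_seq_ratio n z1).
have {}lP : @gamma_seq R ^~ z @ \oo --> (l : R[i]^o).
  by rewrite -(cvg_shiftS (@gamma_seq R ^~ z : nat -> R[i]^o)).
by rewrite /gamma_cvg (gamma_seq_cvgE lP).
Qed.

(** The denominators of index n + 1 at z and z + 1 share z + 1, ..., z + n + 1; the one at
    z + 1 has z + n + 2 in place of z, and its numerator one more power of n + 1. *)
Lemma gamma_seq_addr1 n z : z != 0 -> z + n.+2%:R != 0 ->
  gamma_seq n.+1 z = gamma_seq n.+1 (z + 1) / z * (1 + (z + 1) / n.+1%:R).
Proof.
move=> z0 zn; rewrite /gamma_seq.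
have -> : \prod_(0 <= k < n.+2) (z + k%:R) = z * \prod_(0 <= k < n.+1) (z + 1 + k%:R).
  rewrite big_nat_recl//= addr0; congr (_ * _).
  by apply: eq_bigr => k _; rewrite -natr1; ring.
rewrite [in RHS]big_nat_recr//= mulrDl mul1r CexpD Cexp_real lnK ?posrE ?ltr0n//.
rewrite rmorph_nat.
have n0 : (n.+1%:R : R[i]) != 0 by rewrite pnatr_eq0.
have -> : 1 + (z + 1) / n.+1%:R = (z + 1 + n.+1%:R) / n.+1%:R :> R[i].
  by rewrite [RHS]mulrDl divff// addrC.
have zn0 : z + 1 + n.+1%:R != 0 by rewrite -addrA (addrC 1) natr1.
rewrite !invfM; move: (\prod_(_ <= _ < _) _)^-1 (Cexp _) (n.+1`!%:R : R[i]) => P E F.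
by move: (n.+1%:R : R[i]) n0 zn0 => N N0 zN0; field; rewrite N0 zN0 z0.
Qed.

Lemma cvg_addinvn (c : R[i]) :
  (fun n : nat => 1 + c / n.+1%:R) @ \oo --> (1 : R[i]^o).
Proof.
apply/cvg_normcP => e e0.
have c0 := normc_ge0 c; have /archi_boundP := divr_ge0 c0 (ltW e0).
set m := Num.bound _ => mP; exists m => // n /= mn.
rewrite addrC addKr normcM normcV normc_nat ler_pdivrMr ?ltr0n//.
rewrite mulrC -ler_pdivrMr//; apply: ltW; apply: lt_le_trans mP _.
by rewrite ler_nat leqW.
Qed.

(** Euler's limit at z is obtained from the one at z + 1, since the correcting factor
    1 + (z + 1) / n tends to 1. *)
Lemma gamma_cvg_addr1 z : (forall s : nat, z + s%:R != 0) ->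
  gamma_cvg (z + 1) -> gamma_cvg z /\ Cgamma z = Cgamma (z + 1) / z.
Proof.
move=> zs z1; have z0 : z != 0 by have := zs 0%N; rewrite addr0.
suff H : @gamma_seq R ^~ z @ \oo --> (Cgamma (z + 1) / z : R[i]^o).
  by split; [rewrite /gamma_cvg (gamma_seq_cvgE H)|exact: gamma_seq_cvgE].
rewrite -(cvg_shiftS (@gamma_seq R ^~ z : nat -> R[i]^o)) /=.
under eq_fun do rewrite gamma_seq_addr1 //.
move: z1; rewrite /gamma_cvg -(cvg_shiftS (@gamma_seq R ^~ (z + 1) : nat -> R[i]^o)) /= => z1.
have := @cvg_mul3 (R[i] : numFieldType) _ _ _ _ z^-1 z1 (cvg_addinvn (z + 1)).
by rewrite mulr1.
Qed.

Lemma germ_smooth_inv j a : a != 0 ->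
  @germ_smooth (R[i] : numFieldType) j (fun z => z^-1) a.
Proof.
move=> a0; elim: j => // j IH.
have na : 0 < normc a by rewrite normc_gt0.
exists (fun z => (-1) * (z^-1 * z^-1)).
  apply/nbhs_normP; exists (normc a)%:C => /=; first by rewrite ltcR.
  move=> z /=; rewrite normr_normc ltcR => az; apply/cderivP.
  have z0 : z + 0 != 0.
    by rewrite addr0; apply/eqP => z0; rewrite z0 subr0 ltxx in az.
  have := cderivV z0; under eq_fun do rewrite addr0.
  by move=> H; apply: cderiv_eq H _; rewrite addr0 mulN1r -exprVn expr2.
have c1 : @germ_smooth (R[i] : numFieldType) j (fun=> -1) a.
  elim: (j) (-1 : R[i]) => // i IHi c; exists (fun=> 0) => //.
  by near=> z; exact: is_derive_cst.
exact: germ_smoothM c1 (germ_smoothM IH IH).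
Unshelve. all: by end_near. Qed.

Lemma germ_smooth_gamma_halfplane j a : 1 < complex.Re a ->
  @germ_smooth (R[i] : numFieldType) j (@Cgamma R) a.
Proof.
move=> a1; apply: (tame_limit_smooth (tame_gamma_seq j.+1) _ a1) => z z1.
by have := gamma_cvg_halfplane z1; rewrite /gamma_cvg -(cvg_shiftS (@gamma_seq R ^~ z : nat -> R[i]^o)).
Qed.

(** The poles form a closed set: only finitely many of them lie to the right of a given
    vertical line. *)
Lemma near_addn_neq0 a : (forall s : nat, a + s%:R != 0) ->
  \forall z \near (a : (R[i] : numFieldType)), forall s : nat, z + s%:R != 0.
Proof.
move=> as0.
have H m : \forall z \near (a : (R[i] : numFieldType)),
    forall s : nat, (s < m)%N -> z + s%:R != 0.
  elim: m => [|m IH]; first by near=> z.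
  have N : \forall z \near (a : (R[i] : numFieldType)), z + m%:R != 0.
    apply/nbhs_normP; exists (normc (a + m%:R))%:C => /=.
      by rewrite ltcR normc_gt0.
    move=> z /=; rewrite normr_normc ltcR => az; apply/eqP => zm.
    by move: az; rewrite -(subr0 (a + m%:R)) -zm opprD addrACA subrr addr0 ltxx.
  apply: filterS2 IH N => z zs zm s; rewrite ltnS leq_eqVlt => /orP[/eqP->//|].
  exact: zs.
have /archi_boundP := normc_ge0 a; set m := Num.bound _ => am.
have am' : - m%:R < complex.Re a.
  have [+ _] := normc_ge_abs a; rewrite ler_norml => /andP[+ _].
  by apply: lt_le_trans; rewrite ltrN2.
apply: filterS2 (H m) (near_Re_gt am') => z zs zm s.
have [/zs//|ms] := ltnP s m; apply/eqP => /(congr1 (@complex.Re R)).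
rewrite ReD -(rmorph_nat (real_complex R)) /= => zs0.
have : (m%:R : R) <= s%:R by rewrite ler_nat.
by lra.
Unshelve. all: by end_near. Qed.

(** Induction on the number m of unit steps to the right that bring a into the
    half-plane Re z > 1.  Convergence is needed in a neighbourhood, in order to have
    Gamma(z) = Gamma(z + 1) / z as an equality of germs. *)
Lemma gamma_regular (m : nat) a : 1 - m%:R < complex.Re a ->
  (forall s : nat, a + s%:R != 0) ->
  (\forall z \near (a : (R[i] : numFieldType)), gamma_cvg z) /\
  forall j, @germ_smooth (R[i] : numFieldType) j (@Cgamma R) a.
Proof.
elim: m a => [|m IH] a.
  rewrite subr0 => a1 _; split; last by move=> j; exact: germ_smooth_gamma_halfplane.
  by apply: filterS (near_Re_gt a1) => z; exact: gamma_cvg_halfplane.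
move=> am as0.
have [] := IH (a + 1).
- by rewrite ReD /=; move: am; rewrite -natr1; lra.
- by move=> s; rewrite -addrA (addrC 1) natr1.
move=> /(@near_addr (R[i] : numFieldType)) c1 g1.
have nz := near_addn_neq0 as0.
have H : \forall z \near (a : (R[i] : numFieldType)),
    gamma_cvg z /\ Cgamma z = Cgamma (z + 1) / z.
  by apply: filterS2 nz c1 => z; exact: gamma_cvg_addr1.
split; first by apply: filterS H => z [].
move=> j; have a0 : a != 0 by have := as0 0%N; rewrite addr0.
apply: germ_smooth_near_eq (germ_smoothM (germ_smooth_shift (g1 j)) (germ_smooth_inv j a0)).
by apply: filterS H => z [_ ->].
Qed.

Lemma germ_smooth_gamma j a : (forall s : nat, a + s%:R != 0) ->
  @germ_smooth (R[i] : numFieldType) j (@Cgamma R) a.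
Proof.
move=> as0; have /archi_boundP := normc_ge0 (1 - a); set m := Num.bound _ => am.
have [|_] := @gamma_regular m a _ as0; last exact.
have [+ _] := normc_ge_abs (1 - a) => /(le_trans (ler_norm _)).
by rewrite ReB /=; lra.
Qed.

Lemma near_gamma_addr1 a : (forall s : nat, a + s%:R != 0) ->
  \forall z \near (a : (R[i] : numFieldType)), Cgamma (z + 1) = z * Cgamma z.
Proof.
move=> as0; have /archi_boundP := normc_ge0 (1 - a); set m := Num.bound _ => am.
have [||+ _] := @gamma_regular m (a + 1).
- have [+ _] := normc_ge_abs (1 - a) => /(le_trans (ler_norm _)).
  by rewrite ReB ReD /=; lra.
- by move=> s; rewrite -addrA (addrC 1) natr1.
move=> /(@near_addr (R[i] : numFieldType)) c1.
apply: filterS2 (near_addn_neq0 as0) c1 => z zs /(gamma_cvg_addr1 zs)[_ ->].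
by rewrite mulrC divfK//; have := zs 0%N; rewrite addr0.
Qed.

End GammaFunction.

(** * Jets of polynomials and Hermite interpolation *)

Section JetsOfPolynomials.
Variable K : numFieldType.
Implicit Types (p q r : {poly K}) (a c x : K) (s : seq K).

Lemma derivn_mulXsubC j p a :
  derivn j (p * ('X - a%:P)) = derivn j p * ('X - a%:P) + derivn j.-1 p *+ j.
Proof.
have -> : p * ('X - a%:P) = (p * 'X + 0%:P) - a *: p.
  by rewrite mulrBr addr0 [p * a%:P]mulrC mul_polyC.
rewrite derivnB derivnZ; case: j => [|j].
  by rewrite !derivn0 mulr0n addr0 mulrBr addr0 [p * a%:P]mulrC mul_polyC.
by rewrite derivnMXaddC mulrBr [_ * a%:P]mulrC mul_polyC -addrA addrC.
Qed.

Lemma dvd_jet_eq0 m r a : ('X - a%:P) ^+ m %| r ->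
  forall j, (j < m)%N -> (derivn j r).[a] = 0.
Proof.
move=> /dvdpP[q ->]; elim: m q => // m IH q j jm.
rewrite exprSr mulrA derivn_mulXsubC hornerD hornerM hornerXsubC subrr mulr0 add0r.
case: j jm => [|j] jm; first by rewrite mulr0n horner0.
by rewrite hornerMn IH ?mul0rn.
Qed.

Lemma jet_eq0_dvd m r a : (forall j, (j < m)%N -> (derivn j r).[a] = 0) ->
  ('X - a%:P) ^+ m %| r.
Proof.
elim: m r => [|m IH] r H; first by rewrite expr0 dvd1p.
have /factor_theorem[q rE] : root r a by apply/rootP; have := H 0%N isT.
rewrite rE exprSr dvdp_mul2r ?polyXsubC_eq0//; apply: IH => j jm.
have := H j.+1 jm; rewrite rE derivn_mulXsubC hornerD hornerM hornerXsubC subrr.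
by rewrite mulr0 add0r hornerMn => /eqP; rewrite mulrn_eq0 => /orP[|/eqP].
Qed.

(** This is what allows one to prescribe one more derivative at a without changing
    the jets already matched. *)
Lemma mup_jet_neq0 q a : q != 0 -> (derivn (mup a q) q).[a] != 0.
Proof.
move=> q0; apply/eqP => H.
suff : ('X - a%:P) ^+ (mup a q).+1 %| q by rewrite -mup_geq// ltnn.
apply: jet_eq0_dvd => j; rewrite ltnS leq_eqVlt => /orP[/eqP->//|].
by apply: dvd_jet_eq0; rewrite -mup_geq.
Qed.

(** Nodes are listed with multiplicity and added one at a time.  For a new node x, a
    multiple of P := prod_(y <- s) (X - y) is added: P has vanishing jets at the
    nodes of s, and a nonzero derivative of order mult(x) at x. *)
Lemma hermite_interpolation s (v : K -> nat -> K) :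
  exists p, forall a j, (j < count_mem a s)%N -> (derivn j p).[a] = v a j.
Proof.
elim: s => [|x s [p pv]]; first by exists 0.
pose P := \prod_(y <- s) ('X - y%:P).
have P0 : P != 0 by rewrite monic_neq0// monic_prod_XsubC.
have muP a : mup a P = count_mem a s by exact: mu_prod_XsubC.
pose m := count_mem x s.
have Pm : (derivn m P).[x] != 0 by rewrite /m -muP mup_jet_neq0.
exists (p + ((v x m - (derivn m p).[x]) / (derivn m P).[x]) *: P) => a j /= js.
rewrite derivnD derivnZ hornerD hornerZ.
have [ja|ja] := ltnP j (count_mem a s).
  rewrite pv// (@dvd_jet_eq0 (count_mem a s) P) ?mulr0 ?addr0//.
  by rewrite -muP -mup_geq.
have xa : x = a by move: js; case: eqP => // _; rewrite add0n ltnNge ja.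
rewrite -xa in js ja *.
move: js; rewrite eqxx add1n ltnS => js.
have -> : j = m by apply/eqP; rewrite eqn_leq js ja.
by rewrite divfK// addrC subrK.
Qed.

Lemma prod_XsubC_dvd s r :
  (forall a, ('X - a%:P) ^+ (count_mem a s) %| r) -> \prod_(y <- s) ('X - y%:P) %| r.
Proof.
have [->|r0] := eqVneq r 0; first by rewrite dvdp0.
move=> H; have {}H a : (count_mem a s <= mup a r)%N by rewrite mup_geq.
elim: s r r0 H => [|x s IH] r r0 H; first by rewrite big_nil dvd1p.
have : (0 < mup x r)%N by apply: leq_trans (H x); rewrite /= eqxx.
rewrite -XsubC_dvd// => /dvdpP[q rE].
have q0 : q != 0 by apply: contraNneq r0 => q0; rewrite rE q0 mul0r.
rewrite big_cons rE mulrC dvdp_mul2r ?polyXsubC_eq0//; apply: IH => // a.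
have := H a; rewrite rE mupM ?polyXsubC_eq0// -['X - x%:P]expr1 mup_XsubCX /=.
by case: eqP => _; rewrite ?add0n ?addn0// addnC leq_add2r.
Qed.

Lemma derivn_comp_shift j q c :
  derivn j (q \Po ('X + c%:P)) = derivn j q \Po ('X + c%:P).
Proof.
elim: j q => // j IH q; rewrite !derivSn -IH deriv_comp.
by rewrite derivD derivX derivC addr0 mulr1.
Qed.

Lemma horner_mx_shift N (M : 'M[K]_N.+1) q c :
  horner_mx M (q \Po ('X + c%:P)) = horner_mx (M + c%:M) q.
Proof.
elim/poly_ind: q => [|q d IH]; first by rewrite comp_poly0 !rmorph0.
rewrite comp_polyD comp_polyM comp_polyX comp_polyC !rmorphD !rmorphM /= IH.
by rewrite rmorphD /= !horner_mx_X !horner_mx_C.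
Qed.

End JetsOfPolynomials.

(** * Functional equations in the functional calculus *)

Section FunctionalCalculus.
Variables (K : numClosedFieldType) (N : nat).
Implicit Types (M : 'M[K]_N.+1) (f : K -> K).

Lemma mxminpoly_split M : exists s : seq K,
  mxminpoly M = \prod_(y <- s) ('X - y%:P) /\
  forall a, mup a (mxminpoly M) = count_mem a s.
Proof.
have [s E] := closed_field_poly_normal (mxminpoly M).
move: E; rewrite (eqP (mxminpoly_monic M)) scale1r => E.
by exists s; split=> // a; rewrite E mu_prod_XsubC.
Qed.

Lemma mxfun_interp f M : exists2 p, jet_interp f M p & mxfun f M = horner_mx M p.
Proof.
exists (xget 0 (jet_interp f M)) => //.
apply: xgetPex; have [s [_ mE]] := mxminpoly_split M.
have [p pv] := hermite_interpolation s (fun a j => derive1n j f a).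
by exists p => a j; rewrite mE; exact: pv.
Qed.

(** The minimal polynomial of M divides the translate by c of the one of M + c, since
    that translate annihilates M. *)
Lemma mup_mxminpoly_shift M a c :
  (mup a (mxminpoly M) <= mup (a + c) (mxminpoly (M + c%:M)))%N.
Proof.
rewrite mup_geq ?monic_neq0 ?mxminpoly_monic//; apply: jet_eq0_dvd => j ja.
have -> : a + c = ('X + c%:P).[a] by rewrite hornerD hornerX hornerC.
rewrite -horner_comp -derivn_comp_shift.
apply: (@dvd_jet_eq0 _ (mup a (mxminpoly M))) => //.
apply: dvdp_trans (_ : mxminpoly M %| _).
  by rewrite -mup_geq// monic_neq0// mxminpoly_monic.
by apply: mxminpoly_min; rewrite horner_mx_shift mx_root_minpoly.
Qed.

(** The interpolating polynomials p at M and q at M + 1 give two polynomials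
    q(X + 1) and X p(X) with equal jets on the spectrum of M, to the order required by
    the minimal polynomial, which therefore divides their difference. *)
Lemma mxfun_functional_equation f M :
  (forall a, root (mxminpoly M) a -> (forall j, germ_smooth j f a) /\
     \forall z \near a, f (z + 1) = z * f z) ->
  mxfun f (M + 1) = M * mxfun f M.
Proof.
move=> fM; have [p pM ->] := mxfun_interp f M.
have [q qM ->] := mxfun_interp f (M + 1).
have -> : horner_mx (M + 1) q = horner_mx M (q \Po ('X + 1%:P)).
  by rewrite horner_mx_shift.
rewrite -{2}(horner_mx_X M) -rmorphM; apply/eqP; rewrite -subr_eq0 -rmorphB.
rewrite -dvd_mxminpoly; have [s [sP sE]] := mxminpoly_split M; rewrite sP.
apply: prod_XsubC_dvd => a; rewrite -sE; apply: jet_eq0_dvd => j ja.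
have /fM[fa feq] : root (mxminpoly M) a.
  rewrite -dvdp_XsubCl XsubC_dvd ?monic_neq0 ?mxminpoly_monic//.
  exact: leq_ltn_trans (leq0n j) ja.
rewrite derivnB hornerD hornerN derivn_comp_shift horner_comp hornerD hornerX hornerC.
rewrite qM; last by apply: leq_trans ja _; exact: mup_mxminpoly_shift.
rewrite -derive1n_comp_shift (nbhs_singleton (derive1n_near_eq j feq)).
rewrite (nbhs_singleton (derive1n_idM (leqnn j) (fa j))).
have -> : 'X * p = p * ('X - 0%:P) by rewrite subr0 mulrC.
rewrite derivn_mulXsubC hornerD hornerM hornerXsubC subr0 hornerMn.
rewrite (pM a j ja).
case: j ja => [|j] ja /=; first by rewrite mul0r mulr0n !addr0 mulrC subrr.
by rewrite (pM a j (ltnW ja)) mulrC mulr_natl subrr.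
Qed.

End FunctionalCalculus.

(** * Commutation, Pochhammer matrices and the terminating series *)

Section MatrixLimits.
Variables (K : numClosedFieldType) (N : nat).
Implicit Types (M P Q T Y : 'M[K]_N.+1) (u : nat -> 'M[K]_N.+1).

(** A convergent sequence is treated entrywise; a divergent one has as its limit the
    distinguished point 0 of the space of matrices, which commutes with everything. *)
Lemma limn_mx_comm u Y : (forall n, GRing.comm (u n) Y) -> GRing.comm (limn u) Y.
Proof.
move=> uY; have [uc|/dvgP ->] := pselect (cvgn u); last first.
  have -> : (point : 'M[K]_N.+1) = 0 by apply/matrixP => i j; rewrite !mxE.
  exact/commr_sym/commr0.
apply/matrixP => i j.
have ul p q : (fun n => u n p q) @ \oo --> (limn u) p q.
  apply: (@cvg_comp _ _ _ u (fun M : 'M[K]_N.+1 => M p q) _ (nbhs (limn u))) => //.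
  exact: coord_continuous.
have lY : (fun n => (u n * Y) i j) @ \oo --> (limn u * Y) i j.
  rewrite mxE; under eq_fun do rewrite mxE.
  by apply: cvg_big => [|k _]; [exact: add_continuous|apply: cvgM; [exact: ul|exact: cvg_cst]].
have Yl : (fun n => (u n * Y) i j) @ \oo --> (Y * limn u) i j.
  have -> : (fun n => (u n * Y) i j) = (fun n => \sum_k Y i k * u n k j).
    by apply/funext => n; rewrite uY mxE.
  rewrite mxE.
  by apply: cvg_big => [|k _]; [exact: add_continuous|apply: cvgM; [exact: cvg_cst|exact: ul]].
exact: (cvg_unique (@norm_hausdorff _ _) lY Yl).
Qed.

Lemma mxexp_comm M Y : GRing.comm M Y -> GRing.comm (mxexp M) Y.
Proof.
move=> MY; apply: limn_mx_comm => n; apply/commr_sym; rewrite /series /=.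
apply: commr_sum => k _; apply: commr_sym.
rewrite /GRing.comm -scalerAl -scalerAr; congr (_ *: _).
exact/commr_sym/commrX/commr_sym.
Qed.

Lemma horner_mx_commr M Y (p : {poly K}) : GRing.comm M Y -> GRing.comm (horner_mx M p) Y.
Proof.
move=> MY; elim/poly_ind: p => [|p c IH]; first by rewrite rmorph0; exact/commr_sym/commr0.
rewrite rmorphD rmorphM /= horner_mx_X horner_mx_C; apply/commr_sym.
apply: commrD; first by apply: commrM; exact: commr_sym.
by rewrite /GRing.comm; apply/esym/comm_scalar_mx.
Qed.

Lemma mxfun_comm f M Y : GRing.comm M Y -> GRing.comm (mxfun f M) Y.
Proof. exact: horner_mx_commr. Qed.

Lemma natmx (n : nat) : n%:R = (n%:R)%:M :> 'M[K]_N.+1.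
Proof. by rewrite -(rmorph_nat (@scalar_mx K N.+1)). Qed.

Lemma mxpochS M k : mxpoch M k.+1 = mxpoch M k * (M + k%:R).
Proof. by rewrite /mxpoch big_nat_recr. Qed.

Lemma mxpoch_comm M Y k : GRing.comm M Y -> GRing.comm (mxpoch M k) Y.
Proof.
move=> MY; apply/commr_sym/commr_prod => i _.
by apply: commrD; [exact: commr_sym|exact: commr_nat].
Qed.

Lemma mxpoch_unit M k : (forall s : nat, M + s%:R \is a GRing.unit) ->
  mxpoch M k \is a GRing.unit.
Proof.
move=> Mu; elim: k => [|k IH]; last by rewrite mxpochS unitrMl.
by rewrite /mxpoch big_nil unitr1.
Qed.

(** For k > n both sides vanish, which makes the hypergeometric series terminate. *)
Lemma mxpoch_oppn (n k : nat) :
  mxpoch (- n%:R) k = ((-1) ^+ k * k`!%:R * 'C(n, k)%:R)%:M :> 'M[K]_N.+1.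
Proof.
elim: k => [|k IH]; first by rewrite /mxpoch big_nil bin0 fact0 !mulr1.
rewrite mxpochS IH !natmx -rmorphN -rmorphD -rmorphM; congr (_%:M).
have [kn|nk] := leqP k n; last first.
  by rewrite !bin_small ?mulr0 ?mul0r// (ltn_trans nk).
rewrite factS natrM exprS.
have H : (k.+1%:R : K) * 'C(n, k.+1)%:R = (n%:R - k%:R) * 'C(n, k)%:R.
  by rewrite -natrB// -!natrM mul_bin_left.
transitivity ((-1) ^+ k * k`!%:R * - ((n%:R - k%:R) * 'C(n, k)%:R) : K); first by ring.
by rewrite -H; ring.
Qed.

Definition hyp12_coef P Q k := (mxpoch P k)^-1 * (mxpoch Q k)^-1.

Lemma mxhyp12_oppn (n : nat) Q T (w : K) :
  mxhyp12 (- n%:R) Q T w =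
  \sum_(k < n.+1) ((- w) ^+ k * 'C(n, k)%:R) *: hyp12_coef Q T k.
Proof.
apply: (lim_near_cst (@norm_hausdorff _ _)); exists n.+1 => // m /= nm.
rewrite /series /= big_mkord (big_ord_widen_cond _ (fun _ => true)
   (fun k => ((- w) ^+ k * 'C(n, k)%:R) *: hyp12_coef Q T k) nm) [RHS]big_mkcond /=.
apply: eq_bigr => k _; rewrite mxpoch_oppn -mulrA [_%:M * _]mul_scalar_mx scalerA.
have k0 : (k`!%:R : K) != 0 by rewrite pnatr_eq0 -lt0n fact_gt0.
case: ltnP => kn; last by rewrite bin_small// !mulr0 scale0r.
by congr (_ *: _); rewrite [in RHS]exprNn; field.
Qed.

End MatrixLimits.

(** * The recurrence for the polynomial part *)

Section BinomialIdentities.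
Variable K : comNzRingType.

(* The value 'C(n, k - 1), with the convention 'C(n, -1) = 0. *)
Definition binpred (n k : nat) : nat := if k is k'.+1 then 'C(n, k') else 0%N.

Lemma bin_pascal (n k : nat) : 'C(n.+1, k) = ('C(n, k) + binpred n k)%N.
Proof. by case: k => [|k]; rewrite ?bin0 ?binS. Qed.

Lemma binpred_absorb (n k : nat) :
  (n.+2%:R - k%:R) * (binpred n.+1 k)%:R = n.+1%:R * (binpred n k)%:R :> K.
Proof.
case: k => [|k] /=; first by rewrite !mulr0.
have -> : n.+2%:R - k.+1%:R = n.+1%:R - k%:R :> K.
  by rewrite -(natr1 n.+1) -(natr1 k) opprD addrACA subrr addr0.
have [kn|nk] := leqP k n.+1.
  by rewrite -natrB// -!natrM -mul_bin_down.
by rewrite !bin_small ?mulr0// ltnW.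
Qed.

(** The coefficient of (-w)^k (C)_(n-1) D_k / (n-1)! in the recurrence, where
    p, a, c, d stand for the entries of AC, A, C and I.  After expansion by Pascal's
    rule, the difference of the two sides is a combination of the two absorption
    relations (n - k) binomial(n-1, k-1) = (n - 1) binomial(n-2, k-1) and its analogue
    one step down. *)
Lemma bateman_scalar_identity (m k : nat) (p a c d : K) :
  let n := m.+3%:R : K in
  'C(m.+3, k)%:R * (p + (n - 1) * a + n * c + n * (n - 1) * d) =
  'C(m.+2, k)%:R * (p + (n - 1) * a + n * c + n * (n - 1) * d
                    + (n - 1) * (c + a + (2 * n - 2) * d))
  + (binpred m.+2 k)%:R * (p + (k%:R - 1) * a + k%:R * c + k%:R * (k%:R - 1) * d)
  - (n - 1) * 'C(m.+1, k)%:R * (c + a + (3 * n - 4) * d)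
  + (n - 1) * (n - 2) * 'C(m, k)%:R * d.
Proof.
move=> n; have H2 := binpred_absorb m.+1 k; have H1 := binpred_absorb m k.
rewrite (bin_pascal m.+2) (bin_pascal m.+1) (bin_pascal m) !natrD.
have n1 : m.+2%:R = n - 1 by rewrite /n -(natr1 m.+2) addrK.
have n2 : m.+1%:R = n - 2 by rewrite /n -(addn2 m.+1) natrD addrK.
rewrite -/n n1 in H2; rewrite n1 n2 in H1.
move: ('C(m, k)%:R) (binpred m k)%:R (binpred m.+1 k)%:R (binpred m.+2 k)%:R H1 H2.
move: n {n1 n2} (k%:R : K) => n x b0 c0 c1 c2 H1 H2.
apply/eqP; rewrite -subr_eq0; apply/eqP.
transitivity (((n - x) * c2 - (n - 1) * c1) * (a + c + (n + x - 1) * d)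
   - ((n - 1 - x) * c1 - (n - 2) * c0) * ((n - 1) * d)); first by ring.
by rewrite H1 H2 !subrr !mul0r subr0.
Qed.

End BinomialIdentities.

Section BatemanRecurrence.
Variables (K : numClosedFieldType) (N : nat) (A C : 'M[K]_N.+1) (w : K).
Hypothesis AC : GRing.comm A C.
Hypothesis Aunit : forall s : nat, A + 1 + s%:R \is a GRing.unit.
Hypothesis Cunit : forall s : nat, C + s%:R \is a GRing.unit.

Local Notation D := (hyp12_coef (A + 1) C).
Local Notation P := (mxpoch C).

(** The Bateman polynomial stripped of the factor independent of n. *)
Definition bateman_poly (n : nat) :=
  n`!%:R^-1 *: (P n * \sum_(k < n.+1) ((- w) ^+ k * 'C(n, k)%:R) *: D k).

Lemma commr_scalar (X : 'M[K]_N.+1) x : GRing.comm X x%:M.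
Proof. by rewrite /GRing.comm; exact/esym/comm_scalar_mx. Qed.

Lemma commr_add_scalar (Y X : 'M[K]_N.+1) x : GRing.comm Y X -> GRing.comm Y (X + x%:M).
Proof. by move=> YX; apply: commrD => //; exact: commr_scalar. Qed.

Lemma hyp12_coefS k : (A + k.+1%:R%:M) * (C + k%:R%:M) * D k.+1 = D k.
Proof.
have uC : mxpoch C k \is a GRing.unit by exact: mxpoch_unit.
have uA : mxpoch (A + 1) k \is a GRing.unit by exact: mxpoch_unit.
rewrite /hyp12_coef !mxpochS !invrM //.
have -> : A + k.+1%:R%:M = A + 1 + k%:R by rewrite -natmx -addrA [1 + _]addrC natr1.
have -> : C + k%:R%:M = C + k%:R by rewrite natmx.
set X := A + 1 + k%:R; set Z := C + k%:R.
have XZ : GRing.comm X Z.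
  apply: commrD; last exact: commr_nat.
  apply/commr_sym/commrD; last exact: commr_nat.
  by apply: commrD; [exact: commr_sym|exact: commr1].
have AZ : GRing.comm (mxpoch (A + 1) k)^-1 Z.
  apply/commr_sym/commrV/commr_sym/mxpoch_comm; apply: commrD; last exact: commr_nat.
  by apply/commr_sym/commrD; [exact: commr_sym|exact: commr1].
rewrite XZ -mulrA (mulrA X) (mulrA X) (mulrV (Aunit k)) mul1r.
by rewrite mulrA -AZ -mulrA (mulrA Z) (mulrV (Cunit k)) mul1r.
Qed.

(** All terms of the recurrence are brought to the common shape of a sum over k < M of
    (-w)^k E_k (C)_m D_k.  The range is enlarged from n + 1 to M, the additional
    binomial coefficients being 0. *)
Lemma bateman_poly_expand (m n M : nat) (X E : 'M[K]_N.+1) : (n < M)%N ->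
  X * P n = E * P m ->
  X * bateman_poly n =
  \sum_(k < M) ((- w) ^+ k) *: (((n`!%:R^-1 * 'C(n, k)%:R) *: E) * (P m * D k)).
Proof.
move=> nM XE; rewrite /bateman_poly -scalerAr mulrA XE mulr_sumr scaler_sumr.
rewrite (big_ord_widen_cond _ (fun _ => true)
  (fun k => n`!%:R^-1 *: (E * P m * (((- w) ^+ k * 'C(n, k)%:R) *: D k))) nM).
rewrite big_mkcond /=; apply: eq_bigr => k _; case: ltnP => kn.
  by rewrite -scalerAr -scalerAl !scalerA (mulrA E); congr (_ *: _); ring.
by rewrite bin_small// mulr0 scale0r mul0r scaler0.
Qed.

(** Multiplication by -w raises the power of w, and D_(k-1) = (A + k)(C + k - 1) D_k
    re-expresses the result in the same shape. *)
Lemma bateman_poly_shift (n M : nat) : (n.+1 < M)%N ->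
  - w *: bateman_poly n =
  \sum_(k < M) ((- w) ^+ k) *:
    (((n`!%:R^-1 * (binpred n k)%:R) *: ((A + k%:R%:M) * (C + (k%:R - 1)%:M))) * (P n * D k)).
Proof.
case: M => // M; rewrite ltnS => nM.
rewrite -[bateman_poly n]mul1r (@bateman_poly_expand n n M 1 1)// scaler_sumr.
rewrite big_ord_recl /= mulr0 scale0r mul0r scaler0 add0r; apply: eq_bigr => k _.
rewrite -hyp12_coefS scalerA -exprS; congr (_ *: _).
rewrite -!scalerAl mul1r; congr (_ *: _).
have -> : (lift ord0 k)%:R - 1 = k%:R :> K by rewrite -natr1 addrK.
have PA : GRing.comm (P n) (A + k.+1%:R%:M).
  by apply/mxpoch_comm/commr_add_scalar/commr_sym.
have PC : GRing.comm (P n) (C + k%:R%:M) by exact/mxpoch_comm/commr_add_scalar.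
have PAC : GRing.comm (P n) ((A + k.+1%:R%:M) * (C + k%:R%:M)) by exact: commrM.
by rewrite (mulrA (P n)) PAC -(mulrA _ (P n)).
Qed.

Lemma mulAC_expand x y :
  (A + x%:M) * (C + y%:M) = A * C + y *: A + x *: C + (x * y)%:M.
Proof.
rewrite mulrDl !mulrDr rmorphM /= [x%:M * C]mul_scalar_mx (commr_scalar A y).
by rewrite [y%:M * A]mul_scalar_mx !addrA.
Qed.

Lemma mulCA_expand x y :
  (C + y%:M) * (A + x%:M) = A * C + y *: A + x *: C + (x * y)%:M.
Proof.
rewrite -mulAC_expand; apply/commr_add_scalar/commr_sym/commr_add_scalar.
exact: AC.
Qed.

Lemma mxpochC_S k : (C + k%:R%:M) * P k = P k.+1.
Proof.
rewrite mxpochS -natmx; apply/commr_sym/mxpoch_comm/commrD => //.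
exact: commr_nat.
Qed.

Lemma bateman_poly_recurrence (m : nat) :
  let n := m.+3%:R : K in
  n%:M * (A + n%:M) * bateman_poly m.+3 =
  ((C + (n - 1)%:M) * (A + n%:M) + (n - 1)%:M * (C + A + (2 * n - 2)%:M) - w *: 1)
    * bateman_poly m.+2
  - (C + (n - 2)%:M) * (C + A + (3 * n - 4)%:M) * bateman_poly m.+1
  + (C + (n - 2)%:M) * (C + (n - 3)%:M) * bateman_poly m.
Proof.
move=> n.
have lm1 : (m.+1 < m.+4)%N by rewrite !ltnS; exact: leqW (leqnSn m).
have lm : (m < m.+4)%N by exact: ltnW.
have n1 : n - 1 = m.+2%:R by rewrite /n -(natr1 m.+2) addrK.
have n2 : n - 2 = m.+1%:R by rewrite /n -(addn2 m.+1) natrD addrK.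
have n3 : n - 3 = m%:R by rewrite /n -(addn3 m) natrD addrK.
rewrite mulrBl -scalerAl mul1r -scaleNr (@bateman_poly_shift m.+2 m.+4)//.
rewrite (@bateman_poly_expand m.+2 m.+3 m.+4 _ (n%:M * ((A + n%:M) * (C + (n - 1)%:M))))//; last first.
  by rewrite n1 -!mulrA mxpochC_S.
rewrite (@bateman_poly_expand m.+2 m.+2 m.+4 _
  ((C + (n - 1)%:M) * (A + n%:M) + (n - 1)%:M * (C + A + (2 * n - 2)%:M)))//.
rewrite (@bateman_poly_expand m.+2 m.+1 m.+4 _ (C + A + (3 * n - 4)%:M))//; last first.
  have X : GRing.comm (C + (n - 2)%:M) (C + A + (3 * n - 4)%:M).
    apply/commr_add_scalar/commr_sym/commr_add_scalar/commr_sym.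
    by apply: commrD => //; exact: commr_sym.
  by rewrite X -mulrA n2 mxpochC_S.
rewrite (@bateman_poly_expand m.+2 m m.+4 _ 1)//; last first.
  by rewrite mul1r -mulrA n3 mxpochC_S n2 mxpochC_S.
rewrite -big_split -sumrB -big_split /=; apply: eq_bigr => k _.
rewrite -scalerDr -mulrDl -scalerBr -mulrBl -scalerDr -mulrDl; congr (_ *: (_ * _)).
rewrite mulAC_expand mulCA_expand mulAC_expand [n%:M * _]mul_scalar_mx [(n - 1)%:M * _]mul_scalar_mx.
have n0 : n != 0 by rewrite pnatr_eq0.
have n10 : n - 1 != 0 by rewrite n1 pnatr_eq0.
have n20 : n - 2 != 0 by rewrite n2 pnatr_eq0.
have m0 : (m`!%:R : K) != 0 by rewrite pnatr_eq0 -lt0n fact_gt0.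
have f1 : m.+1`!%:R = (n - 2) * m`!%:R :> K by rewrite factS natrM n2.
have f2 : m.+2`!%:R = (n - 1) * ((n - 2) * m`!%:R) :> K by rewrite factS natrM n1 f1.
have f3 : m.+3`!%:R = n * ((n - 1) * ((n - 2) * m`!%:R)) :> K by rewrite factS natrM f2.
(* Both sides are linear in AC, A, C and I, so they are compared entrywise, the entries
   of I being an indeterminate d. *)
rewrite f1 f2 f3; apply/matrixP => i j; rewrite !mxE.
have [d dE] : exists d : K, forall x, x *+ (i == j) = x * d.
  by exists ((i == j)%:R) => x; rewrite mulr_natr.
rewrite !dE.
set q := \sum_(_ < _) _; have := bateman_scalar_identity m k q (A i j) (C i j) d.
rewrite /= -/n; move: (m`!%:R) n n0 n10 n20 m0 {n1 n2 n3 f1 f2 f3} => f n n0 n10 n20 f0.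
move: (k%:R) ('C(m.+3, k)%:R) ('C(m.+2, k)%:R) ('C(m.+1, k)%:R) ('C(m, k)%:R) ((binpred m.+2 k)%:R) (A i j) (C i j) => x b3 b2 b1 b0 c2 a c H.
transitivity (((n - 1) * ((n - 2) * f))^-1 * (b3 * (q + (n - 1) * a + n * c + n * (n - 1) * d))).
  by field; rewrite n0 n10 n20 f0.
by rewrite H; field; rewrite n10 n20 f0.
Qed.

End BatemanRecurrence.

(** * The matrix Gamma function and the recurrence *)

Lemma factor_recurrence_commr (T : pzRingType) (W X0 X1 X2 X3 u0 u1 u2 u3 : T) :
  GRing.comm W X0 -> GRing.comm W X1 -> GRing.comm W X2 -> GRing.comm W X3 ->
  X0 * u0 = X1 * u1 - X2 * u2 + X3 * u3 ->
  X0 * (W * u0) = X1 * (W * u1) - X2 * (W * u2) + X3 * (W * u3).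
Proof.
move=> W0 W1 W2 W3 E; rewrite !mulrA -W0 -W1 -W2 -W3 -!mulrA E.
by rewrite mulrDr mulrBr.
Qed.

Section MatrixGamma.
Variables (R : realType) (N : nat).
Implicit Types (M A B : 'M[R[i]]_N.+1).

(** A root a of the minimal polynomial is an eigenvalue; a + s = 0 would make M + s
    singular. *)
Lemma root_mxminpoly_addn_neq0 M : (forall s : nat, M + s%:R \is a GRing.unit) ->
  forall a, root (mxminpoly M) a -> forall s : nat, a + s%:R != 0.
Proof.
move=> Mu a; rewrite -eigenvalue_root_min => /eigenvalueP[v vM v0] s.
apply: contra v0 => /eqP as0.
have : v *m (M + s%:R) = 0.
  by rewrite natmx mulmxDr vM mul_mx_scalar -scalerDl as0 scale0r.
move=> /(congr1 (fun x => x *m (M + s%:R)^-1)).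
by rewrite mul0mx -mulmxA [_ *m _^-1]mulrV ?Mu// mulmx1 => ->.
Qed.

Lemma mxfun_gamma_addr1 M : (forall s : nat, M + s%:R \is a GRing.unit) ->
  mxfun (@Cgamma R) (M + 1) = M * mxfun (@Cgamma R) M.
Proof.
move=> Mu; apply: mxfun_functional_equation => a /(root_mxminpoly_addn_neq0 Mu) as0.
by split; [move=> j; exact: germ_smooth_gamma|exact: near_gamma_addr1].
Qed.

Lemma mxfun_gamma_addn M (n : nat) : (forall s : nat, M + s%:R \is a GRing.unit) ->
  mxfun (@Cgamma R) (M + n%:R) = mxpoch M n * mxfun (@Cgamma R) M.
Proof.
move=> Mu; elim: n => [|n IH]; first by rewrite addr0 /mxpoch big_nil mul1r.
rewrite -natr1 addrA mxfun_gamma_addr1; last by move=> s; rewrite -addrA -natrD.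
by rewrite IH mulrA natmx mxpochC_S.
Qed.

(** The factor of J_n that does not depend on n. *)
Definition bateman_prefactor A B (z : R[i]) :=
  let C := 2^-1 *: A + B + 1 in
  mxfun (@Cgamma R) C * mxfun (@Crgamma R) (A + 1) * mxfun (@Crgamma R) C * mxcpow z A.

Lemma bateman_prefactor_comm A B z Y : GRing.comm A Y ->
  GRing.comm (2^-1 *: A + B + 1) Y -> GRing.comm (bateman_prefactor A B z) Y.
Proof.
move=> AY CY; have A1Y : GRing.comm (A + 1) Y.
  by apply/commr_sym/commrD; [exact: commr_sym|exact: commr1].
apply/commr_sym; rewrite /bateman_prefactor; apply: commrM; last first.
  apply/commr_sym/mxexp_comm; rewrite /GRing.comm -scalerAl -scalerAr.
  by congr (_ *: _).
by do 2?[apply: commrM]; apply/commr_sym/mxfun_comm.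
Qed.

Lemma bateman_prefactorE (n : nat) A B (z : R[i]) :
  GRing.comm A (2^-1 *: A + B + 1) ->
  (forall s : nat, 2^-1 *: A + B + 1 + s%:R \is a GRing.unit) ->
  bateman n A B z = bateman_prefactor A B z *
    bateman_poly A (2^-1 *: A + B + 1) (z ^+ 2) n.
Proof.
move=> AC Cu; rewrite /bateman mxhyp12_oppn [2^-1 *: A + B + n%:R + 1]addrAC.
rewrite [B + _ *: _]addrC mxfun_gamma_addn// /bateman_poly -scalerAr; congr (_ *: _).
set C := 2^-1 *: A + B + 1 in AC Cu *.
have PW := bateman_prefactor_comm z (commr_sym (mxpoch_comm n (commr_sym AC)))
  (commr_sym (mxpoch_comm n (commr_refl C))).
by rewrite [RHS]mulrA PW /bateman_prefactor -/C !mulrA.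
Qed.

End MatrixGamma.

Theorem theorem4p11 (R : realType) (N : nat) (A B : 'M[R[i]]_N.+1)
    (hAB : A * B = B * A)
    (hA : forall s : nat, A + 1 + s%:R \is a GRing.unit)
    (hB : forall s : nat, 2^-1 *: A + B + 1 + s%:R \is a GRing.unit)
    (n : nat) (hn : (3 <= n)%N)
    (z : R[i]) (hz : ~ (complex.Im z = 0 /\ complex.Re z <= 0)) :
  n%:R * (A + n%:R) * bateman n A B z =
    ((B + n%:R + 2^-1 *: A) * (A + n%:R)
       + (n%:R - 1) * (B + (3 / 2) *: A + 2 * n%:R - 1)
       - z ^+ 2 *: 1) * bateman (n - 1) A B z
    - (B + 2^-1 *: A + n%:R - 1) * (B + (3 / 2) *: A + 3 * n%:R - 3)
        * bateman (n - 2) A B z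
    + (B + 2^-1 *: A + n%:R - 1) * (B + 2^-1 *: A + n%:R - 2)
        * bateman (n - 3) A B z.
Proof.
case: n hn => [|[|[|m]]]// _; rewrite !subSS !subn0.
set C := 2^-1 *: A + B + 1 in hB *.
have AC : GRing.comm A C.
  apply: commrD; last exact: commr1.
  by apply: commrD => //; rewrite /GRing.comm -scalerAl -scalerAr.
rewrite !bateman_prefactorE//.
have rec := bateman_poly_recurrence (z ^+ 2) AC hA hB m.
set W := bateman_prefactor A B z; set n : R[i] := m.+3%:R in rec.
have WA : GRing.comm W A by apply: bateman_prefactor_comm => //; exact: commr_sym.
have WC : GRing.comm W C by exact: bateman_prefactor_comm.
clearbody W; have WS x : GRing.comm W x%:M by exact: commr_scalar.
have nE : m.+3%:R = n%:M :> 'M[R[i]]_N.+1 by rewrite natmx.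
have kE (k : nat) : k%:R * m.+3%:R = (k%:R * n)%:M :> 'M[R[i]]_N.+1.
  by rewrite rmorphM /= -nE -natmx.
have X1 : B + m.+3%:R + 2^-1 *: A = C + (n - 1)%:M.
  by rewrite nE /C; apply/matrixP => i j; rewrite !mxE; case: eqP => _ /=; ring.
have X2 : m.+3%:R - 1 = (n - 1)%:M :> 'M[R[i]]_N.+1 by rewrite nE rmorphB rmorph1.
have X3 : B + (3 / 2) *: A + 2 * m.+3%:R - 1 = C + A + (2 * n - 2)%:M.
  by rewrite kE /C; apply/matrixP => i j; rewrite !mxE; case: eqP => _ /=; field.
have X4 : B + 2^-1 *: A + m.+3%:R - 1 = C + (n - 2)%:M.
  by rewrite nE /C; apply/matrixP => i j; rewrite !mxE; case: eqP => _ /=; ring.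
have X5 : B + (3 / 2) *: A + 3 * m.+3%:R - 3 = C + A + (3 * n - 4)%:M.
  by rewrite kE (natmx R[i] N 3) /C; apply/matrixP => i j; rewrite !mxE; case: eqP => _ /=; field.
have X6 : B + 2^-1 *: A + m.+3%:R - 2 = C + (n - 3)%:M.
  by rewrite nE (natmx R[i] N 2) /C; apply/matrixP => i j; rewrite !mxE; case: eqP => _ /=; ring.
rewrite X1 X2 X3 X4 X5 X6 nE.
have WAn x : GRing.comm W (A + x%:M) by exact: commr_add_scalar.
have WCn x : GRing.comm W (C + x%:M) by exact: commr_add_scalar.
have WCAn x : GRing.comm W (C + A + x%:M) by apply/commr_add_scalar/commrD.
have Ww : GRing.comm W (z ^+ 2 *: 1) by rewrite /GRing.comm -scalerAl -scalerAr commr1.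
apply: factor_recurrence_commr rec.
- exact: commrM (WS _) (WAn _).
- exact: commrB (commrD (commrM (WCn _) (WAn _)) (commrM (WS _) (WCAn _))) Ww.
- exact: commrM (WCn _) (WCAn _).
- exact: commrM (WCn _) (WCn _).
Qed.
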